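(* Let $r\ge 1$ and let $T$ be an $r$-row rectangular (non-skew) fluctuating tableau of type $(c_1,\ldots,c_n)$, and set $t=|c_1|+\cdots+|c_n|$. Let $\sigma\in\mathfrak S_t$ be the long cycle $\sigma(x)=x+1$ for $x<t$, $\sigma(t)=1$, and let $w_0\in\mathfrak S_t$ be $w_0(x)=t+1-x$. Then for all $0\le i\le r$: (i) $\mathrm{prom}_i(T)$ is a permutation of $[t]$; (ii) $\mathrm{prom}_i(T)=\mathrm{prom}_{r-i}(T)^{-1}$; (iii) $\mathrm{prom}_i(\mathcal P(T))=\sigma^{-|c_1|}\circ\mathrm{prom}_i(T)\circ\sigma^{|c_1|}$; (iv) $\mathrm{prom}_i(\mathcal E(T))=w_0\circ\mathrm{prom}_{r-i}(T)\circ w_0$. (Maps are composed right to left.)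
   Context: An $r$-row generalized partition is $\lambda=(\lambda_1,\ldots,\lambda_r)\in\mathbb Z^r$ with $\lambda_1\ge\cdots\ge\lambda_r$. Let $\mathcal A_r$ be the set of subsets $S\subseteq\{\pm1,\ldots,\pm r\}$ all of whose elements have the same sign (including $\emptyset$). For $S\in\mathcal A_r$ put $\mathbf e_S=\sum_{s\in S}\mathbf e_s$ if $S\subseteq\{1,\ldots,r\}$ and $\mathbf e_S=-\sum_{s\in S}\mathbf e_{-s}$ if $S\subseteq\{-1,\ldots,-r\}$, where $\mathbf e_1,\dots,\mathbf e_r$ is the standard basis of $\mathbb Z^r$. An $r$-row fluctuating tableau of length $n$ is a sequence $T=(\lambda^0,\ldots,\lambda^n)$ of $r$-row generalized partitions with $\lambda^k=\lambda^{k-1}+\mathbf e_{S_k}$ for some $S_k\in\mathcal A_r$; its type is $(c_1,\ldots,c_n)$ with $c_k=|S_k|$ if $S_k$ consists of positive numbers and $c_k=-|S_k|$ otherwise. It is non-skew if $\lambda^0=(0,\ldots,0)$; it is rectangular if moreover $\lambda^n_1=\cdots=\lambda^n_r$. It has oscillating type if every $c_k\in\{\pm1\}$. For $\alpha\in\mathbb Z^r$, $\mathrm{sort}(\alpha)$ is its weakly decreasing rearrangement. The promotion–evacuation diagram of $T=(\lambda^0,\ldots,\lambda^n)$ is the family $(\lambda^{i,j})_{0\le i\le n,\ i\le j\le n+i}$ with $\lambda^{0,j}=\lambda^j$, $\lambda^{i,i}=\lambda^0$, $\lambda^{i,n+i}=\lambda^n$ ($1\le i\le n$), and, for $1\le i\le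 n$ and $i<j<n+i$ (in order of increasing $i$, then increasing $j$), $\lambda^{i,j}=\mathrm{sort}(\lambda^{i-1,j}+\lambda^{i,j-1}-\lambda^{i-1,j-1})$. Promotion is $\mathcal P(T)=(\lambda^{1,1},\lambda^{1,2},\ldots,\lambda^{1,n+1})$ (a fluctuating tableau of type $(c_2,\ldots,c_n,c_1)$) and evacuation is $\mathcal E(T)=(\lambda^{n,n},\lambda^{n-1,n},\ldots,\lambda^{0,n})$. Oscillization: $\mathrm{std}(T)$ replaces each step $\lambda^{k-1}\to\lambda^k$ with $S_k=\{s_1<\cdots<s_m\}$ (increasing as integers) by the $m$ single-cell steps $\lambda^{k-1}+\mathbf e_{\{s_1\}},\ \lambda^{k-1}+\mathbf e_{\{s_1\}}+\mathbf e_{\{s_2\}},\ldots,\lambda^k$ (steps with $S_k=\emptyset$ are deleted); it is a fluctuating tableau of oscillating type and length $t=\sum|c_k|$. Promotion functions. Let $T$ be non-skew of oscillating type and length $t$ with promotion–evacuation diagram $(\lambda^{i,j})$. For $u\ne v$ in $[t]$ let $j=v$ if $u<v$ and $j=v+t$ if $u>v$, and define $a,b\in\{\pm1,\ldots,\pm r\}$ by $\lambda^{u-1,j-1}=\lambda^{u,j-1}+\mathbf e_{\{a\}}$ and $\lambda^{u-1,j}=\lambda^{u,j}+\mathbf e_{\{b\}}$ ($a,b$ have the same sign). Set $M_{uv}=\{i:a\le i<b\}$ if $a,b>0$, $M_{uv}=\{i:|b|\le i<|a|\}$ if $a,b<0$, and $M_{uu}=\{0\}$. (This is the paper's promotion matrix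 of $T$.) For $0\le i\le r-1$, $\mathrm{prom}_i(T)$ is the partial function $[t]\rightharpoonup[t]$ with $\mathrm{prom}_i(T)(u)=v$ iff $i\in M_{uv}$ (for each $u$ there is at most one such $v$), and $\mathrm{prom}_r(T):=\mathrm{prom}_0(T)$. For a general non-skew $T$, $\mathrm{prom}_i(T):=\mathrm{prom}_i(\mathrm{std}(T))$, a partial function on $[t]$, $t=\sum_k|c_k|$. *)

(* Defs.v *)
From mathcomp Require Import all_boot all_order all_algebra all_fingroup.

Set Implicit Arguments.
Unset Strict Implicit.
Unset Printing Implicit Defensive.

Import GRing.Theory Num.Theory.
Local Open Scope ring_scope.

Section FluctuatingTableaux.

Variable r : nat.

Definition gen_partition (lam : 'rV[int]_r) : Prop :=
  forall i j : 'I_r, (i <= j)%N -> lam 0 j <= lam 0 i.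

(* The elements of {+-1, ..., +-r}: (false, i) is i + 1, (true, i) is
   -(i + 1), where i ranges over 0, ..., r - 1. *)
Definition signed_index : finType := (bool * 'I_r)%type.

Definition si_val (s : signed_index) : int := (-1) ^+ s.1 * (s.2.+1)%:Z.

Definition same_sign (S : {set signed_index}) : bool :=
  [forall s in S, forall s' in S, s.1 == s'.1].

(* e_{{s}}, i.e. the basis vector e_s if s > 0, and - e_{-s} if s < 0. *)
Definition unit_step (s : signed_index) : 'rV[int]_r :=
  (-1) ^+ s.1 *: delta_mx 0 s.2.

Definition set_step (S : {set signed_index}) : 'rV[int]_r :=
  \sum_(s in S) unit_step s.

Definition step_type (S : {set signed_index}) : int :=
  if [forall s in S, 0 < si_val s] then #|S|%:Z else - #|S|%:Z.

(* T is the sequence (lambda^0, ..., lambda^n), and c is (c_1, ..., c_n). *)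
Definition fluctuating_tableau (c : seq int) (T : seq 'rV[int]_r) : Prop :=
  [/\ size T = (size c).+1,
      forall k, (k < size T)%N -> gen_partition T`_k
    & forall k, (k < size c)%N ->
        exists S : {set signed_index},
          [/\ same_sign S, T`_k.+1 = T`_k + set_step S & c`_k = step_type S]].

Definition non_skew (T : seq 'rV[int]_r) : Prop := T`_0 = 0.

Definition rectangular (T : seq 'rV[int]_r) : Prop :=
  non_skew T /\ forall i j : 'I_r, (last 0 T) 0 i = (last 0 T) 0 j.

Definition tab_length (T : seq 'rV[int]_r) : nat := (size T).-1.

Definition sort_vec (v : 'rV[int]_r) : 'rV[int]_r :=
  \row_k nth 0 (sort (fun x y : int => y <= x) [seq v 0 i | i <- enum 'I_r]) k.

(* lambda^{i, i + d}, for 0 <= d <= n; junk for d > n. *)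
Fixpoint pe_diag (T : seq 'rV[int]_r) (i : nat) : nat -> 'rV[int]_r :=
  match i with
  | 0 => fun d => T`_d
  | i'.+1 =>
    fix row (d : nat) : 'rV[int]_r :=
      match d with
      | 0 => T`_0
      | d'.+1 =>
        if d'.+1 == tab_length T then T`_(tab_length T)
        else sort_vec (pe_diag T i' d'.+2 + row d' - pe_diag T i' d'.+1)
      end
  end.

(* lambda^{i, j}, meaningful for i <= j <= n + i. *)
Definition pe_diagram (T : seq 'rV[int]_r) (i j : nat) : 'rV[int]_r :=
  pe_diag T i (j - i).

Definition promotion (T : seq 'rV[int]_r) : seq 'rV[int]_r :=
  [seq pe_diagram T 1 j | j <- iota 1 (tab_length T).+1].

Definition evacuation (T : seq 'rV[int]_r) : seq 'rV[int]_r :=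
  [seq pe_diagram T (tab_length T - k) (tab_length T)
     | k <- iota 0 (tab_length T).+1].

(* The (unique) S with same_sign S and mu = lam + set_step S, if any. *)
Definition step_set (lam mu : 'rV[int]_r) : {set signed_index} :=
  odflt set0 [pick S | same_sign S & mu == lam + set_step S].

Definition std_step (lam mu : 'rV[int]_r) : seq 'rV[int]_r :=
  scanl (fun v s => v + unit_step s) lam
    (sort (fun s s' => si_val s <= si_val s') (enum (step_set lam mu))).

Definition std (T : seq 'rV[int]_r) : seq 'rV[int]_r :=
  if T is lam :: T' then lam :: flatten (pairmap std_step lam T') else [::].

(* i \in M_{uv}, with u and v in {1, ..., t}, for T of oscillating type. *)
Definition in_prom_matrix (T : seq 'rV[int]_r) (u v i : nat) : bool :=
  if u == v then i == 0%N else
  let j := if (u < v)%N then v else (v + tab_length T)%N in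
  [exists a : signed_index, exists b : signed_index,
    [&& pe_diagram T u.-1 j.-1 == pe_diagram T u j.-1 + unit_step a,
        pe_diagram T u.-1 j == pe_diagram T u j + unit_step b
      & [&& 0 < si_val a, 0 < si_val b & si_val a <= i%:Z < si_val b]
        || [&& si_val a < 0, si_val b < 0
             & `|si_val b| <= i%:Z < `|si_val a|]]].

(* For i <= r.  The index t has to be the length of T; 'I_t stands for
   {1, ..., t} with indices shifted by one.  The value at u is the v such that
   {w | i \in M_{uw}} = {v}. *)
Definition prom_osc (t i : nat) (T : seq 'rV[int]_r) (u : 'I_t) : option 'I_t :=
  let i' := if i == r then 0%N else i in
  [pick v : 'I_t |
    [set w : 'I_t | in_prom_matrix T u.+1 w.+1 i'] == [set v]].

(* The index t has to be the length of std T, i.e. the sum of the |c_k|. *)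
Definition prom (t i : nat) (T : seq 'rV[int]_r) : 'I_t -> option 'I_t :=
  prom_osc i (std T).

End FluctuatingTableaux.

Definition long_cycle (t : nat) : {perm 'I_t} := perm (@ordS_inj t).

Definition longest (t : nat) : {perm 'I_t} := perm (@rev_ord_inj t).

(* Main.v *)
Require Import Defs.
From mathcomp Require Import all_boot all_order all_algebra all_fingroup.
From mathcomp Require Import zify.

(* Everything rests on a symmetry of the promotion-evacuation diagram of a
   rectangular tableau of oscillating type and length t: with f = lambda^t and
   dual v = - rev v, one has lambda^{i,t+k} = f + dual lambda^{k,i}.  It makes
   the promotion matrix symmetric up to i <-> r - i; since in each row of the
   diagram the vertical labels move monotonically between the first and the
   last row of the partitions, they cross each i exactly once, so that prom_i
   is a permutation.

   By the local rules the symmetry reduces to lambda^{i,t} = f + dual lambda^i.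
   For every K, the sum of the K largest parts of lambda^{i,t} is at least the
   one of f + dual lambda^i.  To see this, consider chains of K-subsets of the
   rows that move down from the last K rows to the first K rows while time
   goes from column i to column t; a move of s + 1 to s at time j costs
   lambda^{h,j}_s - lambda^{h,j}_{s+1} in row h of the diagram.  The total cost
   is a piecewise linear expression in the spirit of Greene's theorem, and
   going from one row of the diagram to the next a chain can be replaced by one
   whose cost, corrected by the weights of the end points, is not larger.  In
   row 0 there is a chain of cost 0, because lambda^t is flat, and in row i all
   costs are nonnegative.  The same bound for the evacuation of the tableau,
   whose diagram is a reflection of the given one, is the opposite inequality.

   A general tableau is reduced to its oscillization: a path of cells that
   increase as integers stays increasing under the local rule, which therefore
   can be applied to a whole step S_k at once. *)

Set Implicit Arguments.
Unset Strict Implicit.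
Unset Printing Implicit Defensive.

Import Order.TTheory GRing.Theory Num.Theory.
Local Open Scope ring_scope.


(** * Sorting, and the steps of a tableau *)

Section Sorting.

Variable r : nat.
Implicit Types (v w : 'rV[int]_r) (s : signed_index r).

Lemma unit_stepE s k :
  unit_step s 0 k = if k == s.2 then (if s.1 then -1 else 1) else 0.
Proof.
rewrite /unit_step !mxE eqxx /=.
by case: eqP => _; case: s.1; rewrite ?expr0 ?expr1 ?mulr0 ?mulr1.
Qed.

Lemma add_unitE v s k : (v + unit_step s) 0 k =
  v 0 k + if k == s.2 then (if s.1 then -1 else 1) else 0.
Proof. by rewrite mxE unit_stepE. Qed.

Lemma si_valE s : si_val s = if s.1 then - (s.2.+1)%:Z else (s.2.+1)%:Z.
Proof. by rewrite /si_val; case: s.1; rewrite ?expr0 ?expr1 ?mulN1r ?mul1r. Qed.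

Lemma si_val_inj s t : si_val s = si_val t -> s = t.
Proof.
rewrite !si_valE; case: s t => [[] i] [[] j] /= e; try lia.
  by congr (_, _); apply: val_inj => /=; lia.
by congr (_, _); apply: val_inj => /=; lia.
Qed.

Lemma unit_step_inj : injective (@unit_step r).
Proof.
move=> s t /matrixP est; have := est 0 s.2; have := est 0 t.2.
rewrite !unit_stepE !eqxx; case: s t {est} => [x i] [y j] /=.
rewrite (eq_sym j i); case: eqP => [->|_]; first by case: x y => [] [].
by case: y.
Qed.

Lemma sort_vec_perm v :
  exists s : 'S_r, forall k, sort_vec v 0 k = v 0 (s k).
Proof.
pose t := [tuple v 0 i | i < r].
have/tuple_permP[s es] : perm_eq (sort_tuple (fun x y : int => y <= x) t) t.
  by apply: permEl; apply: perm_sort.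
exists s => k; rewrite mxE.
have -> : [seq v 0 i | i <- enum 'I_r] = t by [].
have -> : sort (fun x y : int => y <= x) t
   = sort_tuple (fun x y : int => y <= x) t by [].
rewrite es -[RHS](tnth_mktuple (fun i => v 0 i)).
by rewrite -(tnth_mktuple (fun i => tnth t (s i)) k) (tnth_nth 0).
Qed.

Lemma sort_vec_partition v : gen_partition (sort_vec v).
Proof.
move=> i j le_ij; rewrite !mxE.
apply: (@sorted_leq_nth _ (fun x y : int => y <= x)) => //.
- by move=> x y z xy yz; apply: le_trans yz xy.
- by apply: sort_sorted => x y; apply: le_total.
- by rewrite inE size_sort size_map size_enum_ord.
- by rewrite inE size_sort size_map size_enum_ord.
Qed.

(** A decreasing vector is determined by the multiset of its entries, so a sort is computed by
    exhibiting a rearrangement. *)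
Lemma sort_vec_uniq v w (s : 'S_r) :
  gen_partition w -> (forall k, w 0 k = v 0 (s k)) -> sort_vec v = w.
Proof.
move=> w_part ews; apply/rowP => k; rewrite mxE.
have -> : sort (fun x y : int => y <= x) [seq v 0 i | i <- enum 'I_r]
   = [seq w 0 i | i <- enum 'I_r].
  apply: (@sorted_eq _ (fun x y : int => y <= x)).
  - by move=> x y z xy yz; apply: le_trans yz xy.
  - by move=> x y; rewrite andbC => /le_anti.
  - by apply: sort_sorted => x y; apply: le_total.
  - rewrite sorted_map; apply: (@sub_sorted _ (relpre val leq)).
      by move=> i j; apply: w_part.
    by rewrite -(@sorted_map _ _ val) val_enum_ord iota_sorted.
  - rewrite perm_sort perm_sym.
    have -> : [seq w 0 i | i <- enum 'I_r] = [seq v 0 i | i <- [seq s i | i <- enum 'I_r]].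
      by rewrite (eq_map ews) -[RHS]map_comp.
    apply: perm_map.
    apply: uniq_perm.
      by rewrite map_inj_uniq ?enum_uniq //; apply: perm_inj.
      exact: enum_uniq.
    move=> i; rewrite mem_enum; apply/mapP.
    by exists ((s^-1)%g i); rewrite ?mem_enum ?permKV.
by rewrite (nth_map k) ?size_enum_ord // nth_ord_enum.
Qed.

Lemma sort_vec_eq v w (s : 'S_r) :
  (forall k, w 0 k = v 0 (s k)) -> sort_vec v = sort_vec w.
Proof.
move=> ews; have [p ep] := sort_vec_perm w.
apply: (@sort_vec_uniq _ _ (p * s)%g); first exact: sort_vec_partition.
by move=> k; rewrite ep ews permM.
Qed.

Definition flat v := forall i j, v 0 i = v 0 j.

Lemma flat0 : flat (0 : 'rV[int]_r).
Proof. by move=> i j; rewrite !mxE. Qed.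

Lemma flat_partition v : flat v -> gen_partition v.
Proof. by move=> v_flat i j _; rewrite (v_flat i j). Qed.

Lemma sort_vec_flatD v w : flat v -> sort_vec (v + w) = v + sort_vec w.
Proof.
move=> v_flat; have [s es] := sort_vec_perm w.
apply: (@sort_vec_uniq _ _ s) => [i j le_ij|k]; rewrite !mxE.
  by rewrite (v_flat i j) lerD2l; have := sort_vec_partition w le_ij; rewrite !mxE.
by rewrite (v_flat k (s k)) -es !mxE.
Qed.

Definition dual v : 'rV[int]_r := \row_k - v 0 (rev_ord k).

Definition dual_index s : signed_index r := (~~ s.1, rev_ord s.2).
Definition opp_index s : signed_index r := (~~ s.1, s.2).
Definition rev_index s : signed_index r := (s.1, rev_ord s.2).

Lemma dualK : involutive dual.
Proof. by move=> v; apply/rowP => k; rewrite !mxE rev_ordK opprK. Qed.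

Lemma dualD v w : dual (v + w) = dual v + dual w.
Proof. by apply/rowP => k; rewrite !mxE opprD. Qed.

Lemma dualN v : dual (- v) = - dual v.
Proof. by apply/rowP => k; rewrite !mxE. Qed.

Lemma dual0 : dual 0 = 0.
Proof. by apply/rowP => k; rewrite !mxE oppr0. Qed.

Lemma dual_partition v : gen_partition v -> gen_partition (dual v).
Proof. by move=> v_part i j le_ij; rewrite !mxE lerN2 v_part //=; lia. Qed.

Lemma dual_sort v : dual (sort_vec v) = sort_vec (dual v).
Proof.
have [s es] := sort_vec_perm v.
pose p : 'S_r := (perm (@rev_ord_inj r) * s * perm (@rev_ord_inj r))%g.
apply/esym/(@sort_vec_uniq _ _ p); first exact/dual_partition/sort_vec_partition.
by move=> k; rewrite mxE es mxE !permM !permE rev_ordK.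
Qed.

Lemma dual_unit s : dual (unit_step s) = unit_step (dual_index s).
Proof.
apply/rowP => k; rewrite mxE !unit_stepE /= -(inj_eq rev_ord_inj) rev_ordK.
by case: eqP => _; case: s.1; rewrite ?oppr0 ?opprK.
Qed.

Lemma opp_unit s : - unit_step s = unit_step (opp_index s).
Proof.
apply/rowP => k; rewrite mxE !unit_stepE /=.
by case: eqP => _; case: s.1; rewrite ?oppr0 ?opprK.
Qed.

Lemma dual_unit_rev s : dual (unit_step s) + unit_step (rev_index s) = 0.
Proof. by rewrite dual_unit -[unit_step (rev_index s)]opprK opp_unit subrr. Qed.

Lemma dual_indexK : involutive dual_index.
Proof. by case=> x i; rewrite /dual_index /= negbK rev_ordK. Qed.

(** Labels of opposite signs are incomparable, so that a chain for [slt] lists the elements of one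
    set of constant sign in increasing order. *)
Definition slt s (t : signed_index r) := (s.1 == t.1) && (si_val s < si_val t).

Lemma slt_trans : transitive slt.
Proof. by move=> t s u /andP[/eqP e1 h1] /andP[/eqP e2 h2]; rewrite /slt e1 e2 eqxx /=; lia. Qed.

Lemma slt_irr : irreflexive slt.
Proof. by move=> s; rewrite /slt ltxx andbF. Qed.

Lemma slt_dual s t : slt (dual_index s) (dual_index t) = slt s t.
Proof.
rewrite /slt !si_valE; case: s t => [[] i] [[] j] //=;
  have := ltn_ord i; have := ltn_ord j; lia.
Qed.

Lemma slt_opp s t : slt (opp_index s) (opp_index t) = slt t s.
Proof. by rewrite /slt !si_valE; case: s t => [[] i] [[] j] //=; lia. Qed.

(** The new cell moves up to the first row of the run on which [v] equals [v 0 i]. *)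
Lemma sort_unit_pos v (i : 'I_r) : gen_partition v ->
  exists j : 'I_r, [/\ sort_vec (v + unit_step (false, i)) = v + unit_step (false, j),
    v 0 j = v 0 i & (j <= i)%N].
Proof.
move=> v_part.
case: (@arg_minnP _ i (fun k => v 0 k == v 0 i) (@nat_of_ord r)) => // j /eqP ej minj.
have le_ji := minj i (eqxx _).
exists j; split=> //; apply: (@sort_vec_uniq _ _ (tperm i j)) => [k l le_kl|k].
  rewrite !add_unitE /=.
  have := v_part _ _ le_kl; case: (l =P j) => [elj|_]; case: (k =P j) => [ekj|nkj]; try lia.
  subst l => h; have : v 0 k != v 0 j.
    apply: contraT; rewrite negbK => /eqP ekj; have := minj k.
    by rewrite ekj ej eqxx => /(_ isT) ?; case: nkj; apply: val_inj => /=; lia.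
  lia.
rewrite !add_unitE /=; case: tpermP => [->|->|/eqP/negPf-> /eqP/negPf->] //.
  by rewrite ej eq_sym.
by rewrite !eqxx ej.
Qed.

(** Dually, a removed cell moves down to the last row of its run; for both signs the label weakly
    decreases as an integer. *)
Lemma sort_unit v s : gen_partition v ->
  exists d, [/\ sort_vec (v + unit_step s) = v + unit_step d,
    v 0 d.2 = v 0 s.2, d.1 = s.1 & si_val d <= si_val s].
Proof.
move=> v_part; case: s => [[] i]; last first.
  have [j [e1 e2 le_ji]] := sort_unit_pos i v_part.
  by exists (false, j); split=> //; rewrite !si_valE /=; lia.
have [j [e1 e2 le_ji]] := sort_unit_pos (rev_ord i) (dual_partition v_part).
exists (true, rev_ord j); split=> //.
- apply: (can_inj dualK); rewrite dual_sort !dualD !dual_unit /dual_index /=.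
  by rewrite rev_ordK.
- by move: e2; rewrite !mxE rev_ordK => /oppr_inj.
- by rewrite !si_valE /=; move: le_ji => /=; have := ltn_ord i; have := ltn_ord j; lia.
Qed.

End Sorting.


(** * The local rule on a unit square *)

Section LocalRule.

Variable r : nat.
Implicit Types (mu v w : 'rV[int]_r) (a b c d s : signed_index r).

Definition between (i j k : nat) := (i <= k <= j)%N || (j <= k <= i)%N.

(* The possible labels in a square [mu + e_a -> mu + e_a + e_c] over
   [mu -> mu + e_d] of the diagram, where [mu + e_a + e_c = mu + e_d + e_b]. *)
Definition square_rel mu a b c d : Prop :=
  [/\ b.1 = a.1, d.1 = c.1,
      [\/ b = a /\ d = c,
          [/\ a.1 = c.1, b = c, d = a & si_val a < si_val b]
        | [/\ c = opp_index a, d = opp_index b & si_val a < si_val b]]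
    & forall k : 'I_r, between a.2 b.2 k -> mu 0 k = mu 0 a.2].

(** If sorting moves the cell up from row [i] to [j < i], then [mu] is constant on these rows, and
    [a] must repair the inequality between rows [i - 1] and [i]: it removes a cell from row [i] (the
    labels cancel) or adds one to row [i - 1] (the labels are swapped). *)
Lemma square_pos mu a (i : 'I_r) :
  let c := (false, i) in
  gen_partition mu -> gen_partition (mu + unit_step a) ->
  gen_partition (mu + unit_step a + unit_step c) ->
  exists b d, [/\ sort_vec (mu + unit_step c) = mu + unit_step d,
    mu + unit_step a + unit_step c = mu + unit_step d + unit_step b
    & square_rel mu a b c d].
Proof.
move=> c mu_part kap_part lam_part.
have [j [ed ej le_ji]] := sort_unit_pos i mu_part.
case: (j =P i) => [eji|nji].
  subst j; exists a, c; split=> //; first by rewrite addrAC.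
  split=> //; first by constructor 1.
  by case: a {kap_part lam_part} => x l k; rewrite /between /= => hk; congr (mu 0 _); apply: val_inj => /=; lia.
have lt_ji : (j < i)%N.
  by rewrite ltn_neqAle le_ji andbT; apply/eqP => h; apply: nji; apply: val_inj.
have lt_pr : (i.-1 < r)%N by have := ltn_ord i; lia.
pose p := Ordinal lt_pr.
have mu_const (k : 'I_r) : (j <= k <= i)%N -> mu 0 k = mu 0 i.
  move=> /andP[jk ki]; have := mu_part _ _ jk; have := mu_part _ _ ki; lia.
have epi : (p == i) = false by apply/negbTE/eqP => /(congr1 val) /=; lia.
have h1 : mu 0 p = mu 0 i by apply: mu_const => /=; lia.
have := lam_part p i; rewrite !add_unitE /= eqxx epi h1.
have le_pi : (p <= i)%N by rewrite /=; lia.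
move=> /(_ le_pi) h2.
case: a kap_part lam_part h2 => [[] k] kap_part lam_part /=.
  have [eik|//] := eqVneq i k; last by case: (p == k) => /= ?; lia.
  move: kap_part lam_part; rewrite -eik => kap_part lam_part _.
  exists (true, j), (false, j); split=> //.
    rewrite -!addrA !(addrC (unit_step (true, _))) -(opp_unit (false, _)).
    by rewrite -(opp_unit (false, j)) !subrr.
  split=> //.
    constructor 3; split=> //; first by rewrite !si_valE /=; lia.
  by move=> l; rewrite /between /= => hl; apply: mu_const; lia.
have [epk|//] := eqVneq p k; last by case: (i == k) => /= ?; lia.
move: kap_part lam_part; rewrite -epk => kap_part lam_part _.
(* Otherwise the row above [p] has the same entry in [mu], and adding a cell to row [p] does not
   give a partition. *)
have ejp : j = p.
  apply: val_inj => /=; case: (ltngtP j i.-1) => // [lt_jp|]; last lia.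
  have lt_qr : (p.-1 < r)%N by rewrite /=; lia.
  have := kap_part (Ordinal lt_qr) p; rewrite !add_unitE /= eqxx h1.
  have -> : (Ordinal lt_qr == p) = false by apply/negbTE/eqP => /(congr1 val) /=; lia.
  rewrite mu_const /=; last lia.
  by lia.
exists c, (false, p); split=> //; first by rewrite ed ejp.
split=> //; first by constructor 2; split=> //; rewrite !si_valE /=; lia.
by move=> l; rewrite /between /= => hl; rewrite h1; apply: mu_const; rewrite ejp /=; lia.
Qed.

(** A negative [c] becomes positive under [dual], which commutes with sorting. *)
Lemma square mu a c :
  gen_partition mu -> gen_partition (mu + unit_step a) ->
  gen_partition (mu + unit_step a + unit_step c) ->
  exists b d, [/\ sort_vec (mu + unit_step c) = mu + unit_step d,
    mu + unit_step a + unit_step c = mu + unit_step d + unit_step b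
    & square_rel mu a b c d].
Proof.
case: c => [[] i]; last exact: square_pos.
move=> /dual_partition mu_part /dual_partition kap_part /dual_partition lam_part.
rewrite !dualD !dual_unit in kap_part lam_part.
have [b [d [e1 e2 [b1 d1 cases mu_flat]]]] := square_pos mu_part kap_part lam_part.
exists (dual_index b), (dual_index d); split.
- by apply: (can_inj (@dualK r)); rewrite dual_sort !dualD !dual_unit !dual_indexK.
- by apply: (can_inj (@dualK r)); rewrite !dualD !dual_unit !dual_indexK.
case: a b d {e1 e2 kap_part lam_part} b1 d1 cases mu_flat => [x k] [y l] [z m] /=.
rewrite /square_rel /dual_index /opp_index !si_valE /= => -> -> cases mu_flat.
split=> //=; first by rewrite negbK.
  case: cases => [[e1 e2]|[e0 e1 e2 lt_ab]|[e1 e2 lt_ab]];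
    have /= f1 := congr1 snd e1; have /= f2 := congr1 snd e2.
  - by constructor 1; rewrite f1 f2 !rev_ordK negbK.
  - constructor 2; rewrite f1 f2 !rev_ordK; split=> //; move: e0 lt_ab; rewrite f1;
      case: x {e1 e2 mu_flat} => //= _; have := ltn_ord k; have := ltn_ord i; lia.
  - constructor 3; have /= g1 := congr1 fst e1; rewrite f2.
    have f3 := rev_ord_inj f1; have x0 : x = false by case: (x) g1.
    move: lt_ab; rewrite f3 x0 => lt_ab; split=> //; move: lt_ab => /=.
    by have := ltn_ord k; have := ltn_ord l; lia.
move=> n hn; have := mu_flat (rev_ord n); rewrite /= !mxE !rev_ordK => h.
apply: oppr_inj; apply: h; move: hn; rewrite /between /=.
by have := ltn_ord k; have := ltn_ord l; have := ltn_ord n; lia.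
Qed.

Lemma square_rel_le mu a b c d : square_rel mu a b c d -> si_val a <= si_val b.
Proof. by case=> _ _ [[->] | [_ _ _ /ltW] | [_ _ /ltW]]. Qed.

(** The local rule is an involution: the vector to be sorted is [mu + unit_step b], and [mu] has
    equal entries in the rows of [a] and [b]. *)
Lemma square_inverse mu a b c d : square_rel mu a b c d ->
  gen_partition (mu + unit_step a) ->
  mu + unit_step a + unit_step c = mu + unit_step d + unit_step b ->
  sort_vec (mu + unit_step a + unit_step c + mu - (mu + unit_step d))
    = mu + unit_step a.
Proof.
move=> [b1 d1 cases mu_flat] kap_part e.
have -> : mu + unit_step a + unit_step c + mu - (mu + unit_step d) = mu + unit_step b.
  by apply/eqP; rewrite e subr_eq (addrAC mu) (addrC mu (unit_step d)) addrA.
apply: (@sort_vec_uniq _ _ _ (tperm a.2 b.2)) => // k.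
have mu_b : mu 0 b.2 = mu 0 a.2 by apply: mu_flat; rewrite /between; lia.
rewrite !add_unitE b1; case: tpermP => [->|->|/eqP/negPf-> /eqP/negPf->] //.
  by rewrite !eqxx mu_b.
by rewrite mu_b eq_sym.
Qed.

(** Once row [d.2] has been changed, the run in which the second cell can move no longer reaches it,
    so the order of the two cells is kept. *)
Lemma sort_unit2 v s t : gen_partition v -> slt s t ->
  exists d e, [/\ slt d e, sort_vec (v + unit_step s) = v + unit_step d,
    sort_vec (v + unit_step d + unit_step t) = v + unit_step d + unit_step e
   & sort_vec (v + unit_step d + unit_step t) = sort_vec (v + unit_step s + unit_step t)].
Proof.
move=> v_part /andP[/eqP st1 lt_st].
have [d [ed vd d1 le_ds]] := sort_unit s v_part.
have vd_part : gen_partition (v + unit_step d) by rewrite -ed; apply: sort_vec_partition.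
have [e [ee ve e1 le_et]] := sort_unit t vd_part.
exists d, e; split=> //.
  rewrite /slt d1 e1 st1 eqxx /=; rewrite ltNge; apply/negP => le_ed.
  move: ve; rewrite !add_unitE.
  have ne_td : t.2 == d.2 = false.
    apply/negbTE/eqP => etd; have: t = d by rewrite [t]surjective_pairing -st1 -d1 etd -surjective_pairing.
    by move=> ?; subst t; lia.
  rewrite ne_td addr0.
  move: lt_st le_ds le_et le_ed vd d1 e1 st1; rewrite !si_valE.
  case: s d t e {ed ee ne_td} vd_part => [x i] [y j] [z k] [u l] /= vd_part.
  move=> + + + + + yx uz xz; subst y z u.
  case: x vd_part => vd_part lt_st le_ds le_et le_ed vd.
    have := v_part k i; have := vd_part j l; rewrite !add_unitE /= eqxx.
    by case: eqP => _; lia.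
  have := v_part i k; have := vd_part l j; rewrite !add_unitE /= eqxx.
  by case: eqP => _; lia.
have ne (u : signed_index r) : u.1 = s.1 -> si_val u <= si_val s -> t.2 == u.2 = false.
  move=> u1 le_us; apply/negbTE/eqP => etd.
  have: t = u by rewrite [t]surjective_pairing -st1 -u1 etd -surjective_pairing.
  by move=> ?; subst t; lia.
have nd := ne d d1 le_ds; have ns := ne s erefl (lexx _).
apply: (@sort_vec_eq _ _ _ (tperm d.2 s.2)) => k.
rewrite !add_unitE d1; case: tpermP => [->|->|/eqP/negPf-> /eqP/negPf->] //.
  by rewrite (eq_sym d.2 t.2) (eq_sym s.2 t.2) nd ns vd eq_sym.
by rewrite (eq_sym d.2 t.2) (eq_sym s.2 t.2) nd ns vd !eqxx.
Qed.

End LocalRule.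


(** * Chains of sets of rows *)

Section Chains.

Variable r : nat.
Implicit Types (L : nat -> 'rV[int]_r) (A B : {set 'I_r}).

(** The cost is part of the relation because chains with the same end points may have different
    costs. Several jumps may happen at one time. *)
Inductive reach L (A0 : {set 'I_r}) (t0 : nat) : nat -> {set 'I_r} -> int -> Prop :=
| ReachStart : reach L A0 t0 t0 A0 0
| ReachWait t A c : reach L A0 t0 t A c -> reach L A0 t0 t.+1 A c
| ReachJump t A c (s s' : 'I_r) : s' = s.+1 :> nat -> s' \in A -> s \notin A ->
    reach L A0 t0 t A c ->
    reach L A0 t0 t (s |: A :\ s') (c + (L t 0 s - L t 0 s')).

Lemma reach_time L A0 t0 t A c : reach L A0 t0 t A c -> (t0 <= t)%N.
Proof. by elim=> // *; lia. Qed.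

(** A run of occupied rows moves up by one row; the costs of the single jumps telescope. *)
Lemma reach_slide L A0 t0 t A c (y x : 'I_r) : (y < x)%N -> y \notin A ->
  (forall k : 'I_r, (y < k <= x)%N -> k \in A) -> reach L A0 t0 t A c ->
  reach L A0 t0 t (y |: A :\ x) (c + (L t 0 y - L t 0 x)).
Proof.
move=> lt_yx; move: {2}(x - y)%N (leqnn (x - y)) => n.
elim: n A c y lt_yx => [|n IH] A c y lt_yx le_n yA run rA; first by lia.
have lt_y1 : (y.+1 < r)%N by have := ltn_ord x; lia.
pose z := Ordinal lt_y1.
have zA : z \in A by apply: run => /=; lia.
have rz := ReachJump (s' := z) erefl zA yA rA.
have [exz|nxz] := eqVneq x z; first by rewrite exz.
have lt_zx : (z < x)%N.
  rewrite /= ltn_neqAle lt_yx andbT; apply/eqP => h; case/eqP: nxz.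
  by apply: val_inj.
have := IH _ _ z lt_zx _ _ _ rz.
have -> : c + (L t 0 y - L t 0 z) + (L t 0 z - L t 0 x) = c + (L t 0 y - L t 0 x).
  by lia.
have -> : z |: (y |: A :\ z) :\ x = y |: A :\ x.
  apply/setP => k; rewrite !inE.
  have [->|nkz] := eqVneq k z.
    by rewrite (eq_sym z x) nxz zA /= orbT.
  have [->|//] := eqVneq k x.
  by have [exy|//] := eqVneq x y; rewrite exy ltnn in lt_yx.
apply.
- by rewrite /=; lia.
- rewrite !inE eqxx /= orbF; apply/eqP => /(congr1 val) /=; lia.
- move=> k hk; rewrite !inE run; last by move: hk => /=; lia.
  rewrite andbT; have -> : k != z by apply/eqP => ekz; move: hk; rewrite ekz /=; lia.
  by rewrite orbT.
Qed.

(* [x] is the row of the vertical label that separates, at time [t], a row of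
   the diagram from the next one, [L'].  A chain of cost [c] for the former has
   to be replaced by a chain for [L'].  When the label enters [A] one unit of
   cost is missing; it is recovered later because the run of occupied rows that
   ends at [x] can already be shifted at no cost. *)
Definition matched L' A0 t0 (x : 'I_r) t A (c : int) : Prop :=
  (exists2 c', reach L' A0 t0 t A c' & c' <= c - 1) \/
  (exists2 c', reach L' A0 t0 t A c' & c' <= c) /\
  (x \in A -> exists y : 'I_r, [/\ (y < x)%N, y \notin A,
     forall k : 'I_r, (y < k <= x)%N -> k \in A &
     exists2 c', reach L' A0 t0 t (y |: A :\ x) c' & c' <= c]).

(** The label moves down from [x] to [x'] inside a stretch where [L' t] is constant, so slides
    within this stretch are free. The shift to be provided uses the nearest hole above [x']. *)
Lemma matched_wait L' A0 t0 (x x' : 'I_r) t A c : (x <= x')%N ->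
  (forall k : 'I_r, (x <= k <= x')%N -> L' t 0 k = L' t 0 x) ->
  matched L' A0 t0 x t A c -> matched L' A0 t0 x' t.+1 A c.
Proof.
move=> le_xx' flat_x [[c' rA le_c]|[[c' rA le_c] run]].
  by left; exists c' => //; apply: ReachWait.
right; split; first by exists c' => //; apply: ReachWait.
move=> x'A.
have [/existsP[y0 /andP[y0x' y0A]]|full] := boolP [exists y : 'I_r, (y < x')%N && (y \notin A)].
  pose P := [pred y : 'I_r | (y < x')%N && (y \notin A)].
  have Py0 : P y0 by rewrite /= y0x'.
  case: (@arg_maxnP _ y0 P (@nat_of_ord r) Py0) => y /andP[yx' yA] ymax.
  have runy (k : 'I_r) : (y < k <= x')%N -> k \in A.
    move=> hk; apply: contraT => kA; have [ekx'|nkx'] := eqVneq k x'.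
      by rewrite ekx' x'A in kA.
    have := ymax k; rewrite /= kA andbT => /(_ _) h.
    have lt_kx' : (k < x')%N.
      by move: hk nkx' => /andP[_]; rewrite leq_eqVlt => /orP[/eqP/val_inj->|//]; rewrite eqxx.
    by have := h lt_kx'; lia.
  exists y; split=> //.
  (* A hole at or below [x] bounds a run inside the flat stretch. For a hole above [x], the stored
     shift empties row [x] first, and the rows between [x] and [x'] then slide into it at no
     cost. *)
  have [le_xy|lt_yx] := leqP x y.
    exists c' => //; apply: ReachWait.
    have := reach_slide yx' yA runy rA.
    by rewrite !flat_x ?subrr ?addr0 //; lia.
  have xA : x \in A by apply: runy; lia.
  have [z [lt_zx zA runz [c2 r2 le_c2]]] := run xA.
  have ezy : z = y.
    apply: val_inj => /=; case: (ltngtP z y) => // h.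
      by have := runz y; rewrite (negbTE yA); lia.
    by have := runy z; rewrite (negbTE zA); lia.
  rewrite {}ezy in lt_zx zA runz r2.
  exists c2 => //; apply: ReachWait.
  have [exx'|nxx'] := eqVneq x x'; first by rewrite -exx'.
  have lt_xx' : (x < x')%N.
    by rewrite ltn_neqAle le_xx' andbT; apply: contra nxx' => /eqP/val_inj->.
  have nxy : x != y by apply/eqP => exy; rewrite exy ltnn in lt_yx.
  have xB : x \notin y |: A :\ x by rewrite !inE eqxx orbF.
  have runB (k : 'I_r) : (x < k <= x')%N -> k \in y |: A :\ x.
    move=> hk; rewrite !inE runy; last by lia.
    rewrite andbT; have -> : k != x by apply/eqP => ek; move: hk; rewrite ek; lia.
    by rewrite orbT.
  have := reach_slide lt_xx' xB runB r2.
  rewrite !flat_x ?leqnn ?le_xx' // subrr addr0.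
  have -> // : x |: (y |: A :\ x) :\ x' = y |: A :\ x'.
  apply/setP => k; rewrite !inE.
  have [->|nkx] := eqVneq k x; first by rewrite nxx' xA (negbTE nxy) orbT.
  have [->|//] := eqVneq k x'.
  by have [e|//] := eqVneq x' y; rewrite e ltnn in yx'.
(* Without a hole above [x'], row [x] is occupied and its stored shift provides a hole, a
   contradiction. *)
have runx (k : 'I_r) : (k < x')%N -> k \in A.
  move=> lt_k; apply: contraT => kA; case/negP: full; apply/existsP; exists k.
  by rewrite lt_k.
have xA : x \in A.
  by move: le_xx'; rewrite leq_eqVlt => /orP[/eqP/val_inj->|/runx].
have [z [lt_zx zA _ _]] := run xA.
by rewrite runx in zA; lia.
Qed.

(** A jump into row [x] costs one more for [L] than for [L'], and a jump out of row [x] one less: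
    the former gains a unit of slack, the latter spends it or falls back on the stored shift. *)
Lemma matched_jump L L' A0 t0 (x : 'I_r) t A c (s s' : 'I_r) :
  gen_partition (L t) -> gen_partition (L' t) ->
  L t = L' t + unit_step (false, x) ->
  s' = s.+1 :> nat -> s' \in A -> s \notin A ->
  matched L' A0 t0 x t A c ->
  matched L' A0 t0 x t (s |: A :\ s') (c + (L t 0 s - L t 0 s')).
Proof.
move=> L_part L'_part eL es' s'A sA.
have le_ss' : L t 0 s' <= L t 0 s by apply: L_part; lia.
have ge_ss' : L' t 0 s' <= L' t 0 s by apply: L'_part; lia.
have nss' : (s == s') = false by apply/negbTE/eqP => e; move: es'; rewrite e; lia.
rewrite eL !add_unitE /= in le_ss' *.
move=> [[c' rA le_c]|[[c' rA le_c] run]].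
  have rB := ReachJump es' s'A sA rA.
  have [exs'|nxs'] := eqVneq s' x; last first.
    left; exists (c' + (L' t 0 s - L' t 0 s')) => //.
    by case: (s == x); lia.
  right; rewrite -exs' nss'; split.
    by exists (c' + (L' t 0 s - L' t 0 s')) => //; lia.
  by rewrite !inE eqxx /= orbF (eq_sym s') nss'.
have rB := ReachJump es' s'A sA rA.
have [exs|nxs] := eqVneq s x.
  left; rewrite -exs (eq_sym s') nss'.
  by exists (c' + (L' t 0 s - L' t 0 s')) => //; lia.
(* A jump out of row [x] without slack is replaced by the stored shift, whose hole can only be the
   free row [s] next to [x]. *)
have [exs'|nxs'] := eqVneq s' x.
  right; split; last by rewrite -exs' !inE eqxx /= orbF (eq_sym s') nss'.
  have [|y [lt_yx yA runy [c2 r2 le_c2]]] := run; first by rewrite -exs'.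
  have eys : y = s.
    apply: val_inj => /=; rewrite -exs' in lt_yx runy.
    case: (ltngtP y s) => // h; first by have := runy s; rewrite (negbTE sA); lia.
    by lia.
  rewrite eys -exs' in r2; exists c2 => //=.
  by move: le_ss'; rewrite (negbTE nxs) exs' eqxx; lia.
right; split; first by exists (c' + (L' t 0 s - L' t 0 s')) => //; lia.
rewrite !inE (eq_sym x s) (negbTE nxs) (eq_sym x s') nxs' /= => xA.
have [y [lt_yx yA runy [c2 r2 le_c2]]] := run xA.
have neq (i j : 'I_r) : (i != j) = (i != j :> nat) by [].
(* If the jump fills the hole of the stored shift, the vacated row [s'] is the new hole and the
   shifted set stays the same. *)
have [eys|nys] := eqVneq y s.
  subst y.
  have lt_s'x : (s' < x)%N by move: nxs'; rewrite neq; lia.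
  exists s'; split=> //.
  - by rewrite !inE eqxx /= orbF (eq_sym s') nss'.
  - move=> k hk; rewrite !inE runy; last lia.
    by rewrite andbT neq; apply/orP; right; lia.
  - exists c2; last by lia.
    have -> // : s' |: (s |: A :\ s') :\ x = s |: A :\ x.
    apply/setP => k; rewrite !inE.
    have [->|nks'] := eqVneq k s'; first by rewrite nxs' s'A /= orbT.
    by have [->|//] := eqVneq k x; rewrite /= eq_sym (negbTE nxs).
have nys' : y != s' by apply: contraNneq yA => ->.
(* Here the jump does not meet the run, and the shifted chain makes it as well. *)
exists y; split=> //.
- by rewrite !inE (negbTE nys) nys' /=.
- move=> k hk; rewrite !inE runy // andbT.
  have [eks'|nks'] := eqVneq k s'; last by rewrite orbT.
  move: sA; rewrite runy //; move: hk nys nxs nxs'; rewrite eks' !neq; lia.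
exists (c2 + (L' t 0 s - L' t 0 s')); last by rewrite /=; lia.
have -> : y |: (s |: A :\ s') :\ x = s |: (y |: A :\ x) :\ s'.
  apply/setP => k; rewrite !inE.
  have [->|nks] := eqVneq k s; first by rewrite nxs orbT.
  have [->|nky] := eqVneq k y; first by rewrite nys' orbT.
  by rewrite /=; case: (k == x); case: (k == s').
apply: ReachJump => //.
- by rewrite !inE nxs' s'A orbT.
- by rewrite !inE (eq_sym s y) (negbTE nys) (negbTE sA) andbF.
Qed.

(** If the first label lies in [A0], the added 1 is the slack to start with; otherwise no shift has
    to be stored. *)
Lemma reach_row_matched L L' A0 t0 t1 (x : nat -> 'I_r) :
  (forall t, (t0 <= t <= t1)%N -> gen_partition (L t)) ->
  (forall t, (t0 <= t <= t1)%N -> gen_partition (L' t)) ->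
  (forall t, (t0 <= t <= t1)%N -> L t = L' t + unit_step (false, x t)) ->
  (forall t, (t0 <= t < t1)%N -> (x t <= x t.+1)%N) ->
  (forall t (k : 'I_r), (t0 <= t < t1)%N -> (x t <= k <= x t.+1)%N ->
     L' t 0 k = L' t 0 (x t)) ->
  forall t A c, reach L A0 t0 t A c -> (t <= t1)%N ->
    matched L' A0 t0 (x t) t A (c + (x t0 \in A0)%:Z).
Proof.
move=> L_part L'_part eL x_mono x_flat t A c; elim=> {t A c}.
- move=> le_t; rewrite add0r; have [xA|xA] := boolP (x t0 \in A0).
    by left; exists 0; [constructor | lia].
  by right; split=> [|/(negP xA)//]; exists 0; [constructor | lia].
- move=> t A c rA IH lt_t; have h0 := reach_time rA.
  apply: matched_wait (IH _); last by lia.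
    by apply: x_mono; lia.
  by move=> k hk; apply: x_flat => //; lia.
- move=> t A c s s' es' s'A sA rA IH le_t; have h0 := reach_time rA.
  rewrite addrAC; apply: matched_jump (IH le_t) => //.
  - by apply: L_part; lia.
  - by apply: L'_part; lia.
  by apply: eL; lia.
Qed.

End Chains.


(** * Duality for chains, end point corrections and flat vectors *)

Section ChainBounds.

Variable r : nat.
Implicit Types (L : nat -> 'rV[int]_r) (A B : {set 'I_r}).

(** The holes of [A] in reversed order: a jump moves a hole down, and the reversal makes this a jump
    of the same cost for [dual]. *)
Definition dual_set A : {set 'I_r} := [set k | rev_ord k \notin A].

Lemma reach_dual L A0 t0 t A c : reach L A0 t0 t A c ->
  reach (fun t => dual (L t)) (dual_set A0) t0 t (dual_set A) c.
Proof.
elim=> {t A c} [|t A c _ IH|t A c s s' es' s'A sA _ IH].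
- by constructor.
- exact: ReachWait.
have es : rev_ord s = (rev_ord s').+1 :> nat by rewrite /=; have := ltn_ord s'; lia.
have := ReachJump es _ _ IH; rewrite !mxE !inE !rev_ordK s'A sA => /(_ isT isT).
have -> : rev_ord s' |: dual_set A :\ rev_ord s = dual_set (s |: A :\ s').
  apply/setP => k; rewrite !inE negb_or negb_and negbK.
  rewrite -(inj_eq rev_ord_inj k) rev_ordK -(inj_eq rev_ord_inj k (rev_ord s)) rev_ordK.
  have [->|] := eqVneq (rev_ord k) s'; last by [].
  by rewrite /= andbT; apply/esym/eqP => e; rewrite -e s'A in sA.
by rewrite opprK addrC [- _ + _]addrC addrC.
Qed.

Lemma dual_setK : involutive dual_set.
Proof. by move=> A; apply/setP => k; rewrite !inE rev_ordK negbK. Qed.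

Lemma reach_ext L L' A0 t0 t A c : L =1 L' ->
  reach L A0 t0 t A c -> reach L' A0 t0 t A c.
Proof.
move=> eL; elim=> {t A c} [|t A c _ IH|t A c s s' es' s'A sA _ IH].
- by constructor.
- exact: ReachWait.
- by rewrite eL; apply: ReachJump.
Qed.

Definition top K : {set 'I_r} := [set k : 'I_r | (k < K)%N].
Definition psum A (v : 'rV[int]_r) : int := \sum_(k in A) v 0 k.

Lemma psumD A v w : psum A (v + w) = psum A v + psum A w.
Proof. by rewrite /psum -big_split; apply: eq_bigr => k _; rewrite mxE. Qed.

Lemma psumN A v : psum A (- v) = - psum A v.
Proof. by rewrite /psum -sumrN; apply: eq_bigr => k _; rewrite mxE. Qed.

Lemma psum0 A : psum A 0 = 0.
Proof. by rewrite /psum big1 // => k _; rewrite mxE. Qed.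

Lemma psum_unit A s :
  psum A (unit_step s) = if s.2 \in A then (if s.1 then -1 else 1) else 0.
Proof.
rewrite /psum (eq_bigr _ (fun k _ => unit_stepE s k)) -big_mkcondr /=.
case: (boolP (s.2 \in A)) => sA; last first.
  by rewrite big_pred0 // => k; case: eqP => [->|]; rewrite ?(negbTE sA) ?andbF.
by rewrite (big_pred1 s.2) // => k; rewrite /=; case: eqP => [->|]; rewrite ?sA ?andbF.
Qed.

Lemma reach_ge0 L A0 t0 t1 t A c :
  (forall t, (t0 <= t <= t1)%N -> gen_partition (L t)) ->
  reach L A0 t0 t A c -> (t <= t1)%N -> 0 <= c.
Proof.
move=> L_part; elim=> {t A c} [//|t A c _ IH le_t|t A c s s' es' _ _ rA IH le_t].
  by apply: IH; lia.
have h0 := reach_time rA.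
have : L t 0 s' <= L t 0 s by apply: L_part; lia.
by have := IH le_t; lia.
Qed.

(** There is no hole above an occupied row of such a set, so no shift can be stored when [x] is
    occupied, and the slack must be present. *)
Lemma matched_down_closed L' A0 t0 x t A c :
  (forall k l : 'I_r, (k <= l)%N -> l \in A -> k \in A) ->
  matched L' A0 t0 x t A c ->
  exists2 c', reach L' A0 t0 t A c' & c' <= c - (x \in A)%:Z.
Proof.
move=> A_down [[c' rA le_c]|[[c' rA le_c] run]].
  by exists c' => //; case: (x \in A); lia.
exists c' => //; case: (boolP (x \in A)) => [xA|_]; last by lia.
by have [y [lt_yx /negP[]]] := run xA; apply: A_down xA; lia.
Qed.

Lemma reach_row_pos L L' A0 A t0 t1 (x : nat -> 'I_r) c :
  (t0 <= t1)%N ->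
  (forall k l : 'I_r, (k <= l)%N -> l \in A -> k \in A) ->
  (forall t, (t0 <= t <= t1)%N -> gen_partition (L t)) ->
  (forall t, (t0 <= t <= t1)%N -> gen_partition (L' t)) ->
  (forall t, (t0 <= t <= t1)%N -> L t = L' t + unit_step (false, x t)) ->
  (forall t, (t0 <= t < t1)%N -> (x t <= x t.+1)%N) ->
  (forall t (k : 'I_r), (t0 <= t < t1)%N -> (x t <= k <= x t.+1)%N ->
     L' t 0 k = L' t 0 (x t)) ->
  reach L A0 t0 t1 A c ->
  exists2 c', reach L' A0 t0 t1 A c' &
    c' <= c + (x t0 \in A0)%:Z - (x t1 \in A)%:Z.
Proof.
move=> le_t A_down L_part L'_part eL x_mono x_flat rA.
exact/(matched_down_closed A_down)/(reach_row_matched L_part L'_part eL x_mono x_flat rA).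
Qed.

(** The sign of [z] is constant. Negative labels are reduced to positive ones by passing to holes,
    which reverses the sign of the two end point corrections; [psum] covers both signs. *)
Lemma reach_row L L' A0 A t0 t1 (z : nat -> signed_index r) c :
  (t0 <= t1)%N ->
  (forall k l : 'I_r, (k <= l)%N -> l \in A -> k \in A) ->
  (forall t, (t0 <= t <= t1)%N -> gen_partition (L t)) ->
  (forall t, (t0 <= t <= t1)%N -> gen_partition (L' t)) ->
  (forall t, (t0 <= t <= t1)%N -> L t = L' t + unit_step (z t)) ->
  (forall t, (t0 <= t < t1)%N -> [/\ (z t.+1).1 = (z t).1, si_val (z t) <= si_val (z t.+1)
     & forall k : 'I_r, between (z t).2 (z t.+1).2 k -> L' t 0 k = L' t 0 (z t).2]) ->
  reach L A0 t0 t1 A c ->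
  exists2 c', reach L' A0 t0 t1 A c' &
    c' <= c + psum A0 (L t0 - L' t0) - psum A (L t1 - L' t1).
Proof.
move=> le_t A_down L_part L'_part eL z_rel rA.
have z1 t : (t0 <= t <= t1)%N -> (z t).1 = (z t0).1.
  elim: t => [|t IH] ht; first by have -> : t0 = 0%N by lia.
  have [e|lt] : t0 = t.+1 \/ (t0 <= t)%N by lia.
    by rewrite -e.
  by have [|-> _ _] := z_rel t; rewrite ?IH //; lia.
have dL t : (t0 <= t <= t1)%N -> L t - L' t = unit_step (z t).
  by move=> ht; rewrite eL // addrC addKr.
rewrite !dL ?leqnn ?le_t // !psum_unit (z1 t1) ?leqnn ?le_t //.
have z_eq t : (t0 <= t <= t1)%N -> z t = ((z t0).1, (z t).2).
  by move=> ht; rewrite -(z1 t ht) -surjective_pairing.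
case e0: (z t0).1 z_eq => z_eq.
  have := @reach_row_pos (fun t => dual (L t)) (fun t => dual (L' t)) (dual_set A0)
    (dual_set A) t0 t1 (fun t => rev_ord (z t).2) c le_t.
  case.
  - move=> k l le_kl; rewrite !inE; apply: contra => kA.
    by apply: A_down kA => /=; lia.
  - by move=> t ht; apply/dual_partition/L_part.
  - by move=> t ht; apply/dual_partition/L'_part.
  - by move=> t ht; rewrite eL // dualD dual_unit z_eq.
  - move=> t ht; have [_ + _] := z_rel t ht.
    rewrite !si_valE !z1 ?e0 /=; [|lia|lia].
    case: (z t) (z t.+1) => [x i] [y j] /=.
    by have := ltn_ord i; have := ltn_ord j; lia.
  - move=> t k ht hk; have [_ _ zf] := z_rel t ht.
    rewrite !mxE rev_ordK zf //; rewrite /between; apply/orP; right; move: hk => /=.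
    case: (z t) (z t.+1) {zf} => [x i] [y j] /=.
    by have := ltn_ord i; have := ltn_ord j; have := ltn_ord k; lia.
  - exact: reach_dual.
  move=> c' /reach_dual; rewrite !dual_setK !inE !rev_ordK => r' le_c'.
  exists c'; first by apply: reach_ext r' => t; apply: dualK.
  by move: le_c'; case: (_ \in A0) => /=; case: (_ \in A) => /=; lia.
have := @reach_row_pos L L' A0 A t0 t1 (fun t => (z t).2) c le_t A_down L_part L'_part.
case=> //.
- by move=> t ht; rewrite eL // {1}z_eq.
- move=> t ht; have [_ + _] := z_rel t ht.
  by rewrite !si_valE !z1 ?e0 /=; lia.
- move=> t k ht hk; have [_ _ zf] := z_rel t ht.
  by apply: zf; rewrite /between hk.
by move=> c' rA' le_c'; exists c' => //; move: le_c'; case: (_ \in A0) => /=; case: (_ \in A) => /=; lia.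
Qed.

Definition window p K : {set 'I_r} := [set k : 'I_r | (p <= k < p + K)%N].

Lemma window0 K : window 0 K = top K.
Proof. by apply/setP => k; rewrite !inE add0n. Qed.

(** Each shift of the window by one row is a slide, whose cost is a difference of two entries of a
    flat vector. *)
Lemma reach_window L A0 t0 t p K c : flat (L t) -> (p + K <= r)%N -> (0 < K)%N ->
  reach L A0 t0 t (window p K) c -> reach L A0 t0 t (top K) c.
Proof.
move=> L_flat + K_gt0; elim: p => [|p IH] le_r rA; first by rewrite -window0.
apply: IH; first lia.
have lt_p : (p < r)%N by lia.
have lt_q : (p + K < r)%N by lia.
have := @reach_slide r L A0 t0 t _ _ (Ordinal lt_p) (Ordinal lt_q) _ _ _ rA.
rewrite (L_flat _ (Ordinal lt_q)) subrr addr0.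
have -> : Ordinal lt_p |: window p.+1 K :\ Ordinal lt_q = window p K.
  apply/setP => k; rewrite !inE -!(inj_eq val_inj) /=.
  by lia.
apply; rewrite ?inE /=; try lia.
by move=> k; rewrite inE; lia.
Qed.

Lemma reach_wait L A0 t0 t : (t0 <= t)%N -> reach L A0 t0 t A0 0.
Proof.
elim: t => [|t IH] le_t; first by (have -> : t0 = 0%N by lia); apply: ReachStart.
have [->|lt] : t0 = t.+1 \/ (t0 <= t)%N by lia.
  by apply: ReachStart.
by apply: ReachWait; apply: IH.
Qed.

End ChainBounds.


(** * The diagram of an oscillating tableau *)

Section Diagram.

Variable r : nat.
Implicit Types (T : seq 'rV[int]_r) (a b c d : signed_index r).

Lemma pe_diagram0 T j : pe_diagram T 0 j = T`_j.
Proof. by rewrite /pe_diagram subn0. Qed.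

Lemma pe_diagram_start T i : pe_diagram T i i = T`_0.
Proof. by rewrite /pe_diagram subnn; case: i. Qed.

Lemma pe_diagram_end T i : pe_diagram T i (i + tab_length T) = T`_(tab_length T).
Proof.
rewrite /pe_diagram addKn; case: i => [//|i] /=.
by case: (tab_length T) => [//|t]; rewrite eqxx.
Qed.

Lemma pe_diagram_rule T i j : (i < j < i + tab_length T)%N ->
  pe_diagram T i.+1 j.+1 =
  sort_vec (pe_diagram T i j.+1 + pe_diagram T i.+1 j - pe_diagram T i j).
Proof.
move=> hj; rewrite /pe_diagram subSS.
have [k ek] : exists k, (j - i)%N = k.+1 by exists (j - i).-1; lia.
rewrite subSn ?ek /=; last lia.
have -> : (j - i.+1)%N = k by lia.
by have -> : (k.+1 == tab_length T) = false by apply/negbTE/eqP; lia.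
Qed.

(** The rectangular tableaux of oscillating type; flatness at index [t] is rectangularity. *)
Definition oscillating t T : Prop :=
  [/\ size T = t.+1, forall k, (k <= t)%N -> gen_partition T`_k, T`_0 = 0, flat T`_t
    & forall k, (k < t)%N -> exists c, T`_k.+1 = T`_k + unit_step c].

Section Oscillating.

Variables (t : nat) (T : seq 'rV[int]_r).
Hypothesis T_osc : oscillating t T.

Let D := pe_diagram T.

Lemma osc_length : tab_length T = t.
Proof. by case: T_osc => sT _ _ _ _; rewrite /tab_length sT. Qed.

Lemma osc_start i : D i i = 0.
Proof. by rewrite /D pe_diagram_start; case: T_osc. Qed.

Lemma osc_end i : D i (i + t) = T`_t.
Proof. by rewrite /D -{1}osc_length pe_diagram_end osc_length. Qed.

Lemma osc_rule i j : (i < j < i + t)%N ->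
  D i.+1 j.+1 = sort_vec (D i j.+1 + D i.+1 j - D i j).
Proof. by move=> hj; apply: pe_diagram_rule; rewrite osc_length. Qed.

Lemma osc_partition i j : (i <= j <= i + t)%N -> gen_partition (D i j).
Proof.
case: T_osc => _ T_part _ T_flat _.
case: i => [|i] hj; first by rewrite /D pe_diagram0; apply: T_part; lia.
have [->|nij] := eqVneq j i.+1; first by rewrite osc_start; apply/flat_partition/flat0.
have [->|njt] := eqVneq j (i.+1 + t)%N; first by rewrite osc_end; apply/flat_partition.
case: j hj nij njt => [|j] hj nij njt; first by lia.
by rewrite osc_rule; [apply: sort_vec_partition | lia].
Qed.

Definition square_at i j a b c d :=
  [/\ D i j = D i.+1 j + unit_step a, D i j.+1 = D i j + unit_step c,
      D i.+1 j.+1 = D i.+1 j + unit_step d, D i j.+1 = D i.+1 j.+1 + unit_step b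
    & square_rel (D i.+1 j) a b c d].

Lemma osc_square_of i j a c : (i < j < i + t)%N ->
  D i j = D i.+1 j + unit_step a -> D i j.+1 = D i j + unit_step c ->
  exists b d, square_at i j a b c d.
Proof.
move=> hj ea ec.
have [|||b [d [ed eb rel]]] := @square r (D i.+1 j) a c.
- by apply: osc_partition; lia.
- by rewrite -ea; apply: osc_partition; lia.
- by rewrite -ea -ec; apply: osc_partition; lia.
have e : D i.+1 j.+1 = D i.+1 j + unit_step d.
  by rewrite osc_rule // ec -ed; congr sort_vec; rewrite addrAC -(addrC (D i.+1 j)) addrAC subrr add0r.
by exists b, d; split=> //; rewrite ?ec ?ea ?e.
Qed.

Definition row_steps i := forall j, (i <= j < i + t)%N -> exists c, D i j.+1 = D i j + unit_step c.

(** One half of an alternating induction: single-cell steps in row [i] give single-cell steps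
    between rows [i] and [i.+1], and these give the ones in row [i.+1]. *)
Lemma osc_vertical_of i : row_steps i -> forall j, (i < j <= i + t)%N ->
  exists a, D i j = D i.+1 j + unit_step a.
Proof.
move=> steps; elim=> [|j IH] hj; first by lia.
have [c ec] : exists c, D i j.+1 = D i j + unit_step c by apply: steps; lia.
have [eij|lt_ij] : i = j \/ (i < j)%N by lia.
  (* Both rows start with 0, so the first vertical label is the first step of row [i]. *)
  by exists c; rewrite ec -eij !osc_start.
have [|a ea] := IH; first by lia.
have [|b [d [_ _ _ eb _]]] := osc_square_of _ ea ec; first by lia.
by exists b.
Qed.

Lemma osc_row_steps i : row_steps i.
Proof.
elim: i => [|i IH] j hj.
  by rewrite /D !pe_diagram0; case: T_osc => _ _ _ _; apply; lia.
have [a ea] : exists a, D i j = D i.+1 j + unit_step a.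
  by apply: osc_vertical_of IH _ _; lia.
have [ej|lt_j] : (j = i + t \/ j < i + t)%N by lia.
  (* Both rows end with the same vector, one column apart, so the last step of row [i.+1] is the
     last vertical label. *)
  by exists a; rewrite -ea ej osc_end -addSn osc_end.
have [|c ec] := IH j; first by lia.
have [|b [d [_ _ ed _ _]]] := osc_square_of _ ea ec; first by lia.
by exists d.
Qed.

Lemma osc_vertical i j : (i < j <= i + t)%N -> exists a, D i j = D i.+1 j + unit_step a.
Proof. exact/osc_vertical_of/osc_row_steps. Qed.

Lemma osc_square i j : (i < j < i + t)%N -> exists a b c d, square_at i j a b c d.
Proof.
move=> hj; have [|a ea] := @osc_vertical i j; first by lia.
have [|c ec] := @osc_row_steps i j; first by lia.
by have [b [d]] := osc_square_of hj ea ec; exists a, b, c, d.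
Qed.

Lemma osc_inverse_rule i j : (i < j < i + t)%N ->
  D i j = sort_vec (D i j.+1 + D i.+1 j - D i.+1 j.+1).
Proof.
move=> hj; have [a [b [c [d [ea ec ed eb rel]]]]] := osc_square hj.
rewrite ec ed ea (square_inverse rel) //; first by rewrite -ea; apply: osc_partition; lia.
by rewrite -ea -ec -ed.
Qed.

(** The default [a0] is there because no label exists for [r = 0]. *)
Definition vlabel a0 i j := odflt a0 [pick a | D i j == D i.+1 j + unit_step a].

Lemma vlabelP a0 i j a : D i j = D i.+1 j + unit_step a -> vlabel a0 i j = a.
Proof.
rewrite /vlabel => ea; case: pickP => [b /eqP|/(_ a)]; last by rewrite ea eqxx.
by rewrite ea => /addrI/unit_step_inj.
Qed.

Lemma vlabelE a0 i j : (i < j <= i + t)%N -> D i j = D i.+1 j + unit_step (vlabel a0 i j).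
Proof. by move=> hj; have [a ea] := osc_vertical hj; rewrite (vlabelP a0 ea). Qed.

Lemma vlabel_square a0 i j : (i < j < i + t)%N ->
  exists c d, square_at i j (vlabel a0 i j) (vlabel a0 i j.+1) c d.
Proof.
move=> hj; have [a [b [c [d sq]]]] := osc_square hj; exists c, d.
by case: (sq) => ea _ _ eb _; rewrite (vlabelP a0 ea) (vlabelP a0 eb).
Qed.

(** The corrections of [reach_row] telescope over the rows. In row 0 the window waits until time [t]
    and then slides to the top within a flat vector. *)
Lemma osc_reach i K : (i <= t)%N -> (0 < K <= r)%N -> forall h, (h <= i)%N ->
  exists2 c, reach (D h) (window r (r - K) K) i t (top r K) c &
    c <= psum (window r (r - K) K) (D 0 i - D h i) - psum (top r K) (D 0 t - D h t).
Proof.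
move=> le_it /andP[K_gt0 le_Kr]; elim=> [|h IH] le_hi.
  exists 0; last by rewrite !subrr !psum0 subrr.
  apply: (@reach_window r _ _ _ _ (r - K)) => //; last exact: reach_wait.
    by rewrite /D pe_diagram0; case: T_osc.
  by lia.
have [|c rc le_c] := IH; first by lia.
have [a0 _] : exists a, D h i = D h.+1 i + unit_step a by apply: osc_vertical; lia.
have [|||||c' rc' le_c'] := @reach_row r (D h) (D h.+1) _ (top r K) i t (vlabel a0 h) c le_it _ _ _ _ _ rc.
- by move=> k l le_kl; rewrite !inE; lia.
- by move=> j hj; apply: osc_partition; lia.
- by move=> j hj; apply: osc_partition; lia.
- by move=> j hj; apply: vlabelE; lia.
- move=> j hj; have [|c0 [d0 [_ _ _ _ rel]]] := @vlabel_square a0 h j; first by lia.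
  by split; [case: rel | apply: square_rel_le rel | case: rel].
exists c' => //; move: le_c le_c'; rewrite !psumD !psumN; lia.
Qed.

Lemma osc_top_bound i K : (i <= t)%N -> (0 < K <= r)%N ->
  psum (top r K) T`_t <= psum (window r (r - K) K) T`_i + psum (top r K) (D i t).
Proof.
move=> le_it hK; have [c rc le_c] := osc_reach le_it hK (leqnn i).
have c_ge0 : 0 <= c.
  by apply: (reach_ge0 (t1 := t)) rc _ => // j hj; apply: osc_partition; lia.
move: le_c; rewrite /D !pe_diagram0 -/D osc_start subr0 psumD psumN; lia.
Qed.

End Oscillating.

End Diagram.


(** * Sums over the first and the last rows *)

Section PartialSums.

Variable r : nat.
Implicit Types (v w : 'rV[int]_r).

Lemma psum_topS (k : 'I_r) v : psum (top r k.+1) v = psum (top r k) v + v 0 k.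
Proof.
rewrite /psum (bigD1 k) ?inE //= addrC; congr (_ + _).
apply: eq_bigl => l; rewrite !inE -(inj_eq val_inj) /=; lia.
Qed.

Lemma psum_top_inj v w :
  (forall K, (K <= r)%N -> psum (top r K) v = psum (top r K) w) -> v = w.
Proof.
move=> evw; apply/rowP => k.
have := evw k.+1 (ltn_ord k); rewrite !psum_topS evw; last by apply: ltnW.
exact: addrI.
Qed.

Lemma psum_window K v : (K <= r)%N ->
  psum (window r (r - K) K) v = psum setT v - psum (top r (r - K)) v.
Proof.
move=> le_K; suff -> : psum setT v = psum (top r (r - K)) v + psum (window r (r - K) K) v.
  by rewrite addrC addKr.
rewrite /psum (bigID (fun k => k \in top r (r - K))) /=.
congr (_ + _); apply: eq_bigl => k; rewrite !inE //.
by have := ltn_ord k; lia.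
Qed.

Lemma psum_dual K v : (K <= r)%N ->
  psum (top r K) (dual v) = psum (top r (r - K)) v - psum setT v.
Proof.
move=> le_K; rewrite -opprB -psum_window // -psumN /psum.
rewrite (reindex_inj rev_ord_inj) /=; apply: eq_big => k.
  by rewrite !inE /=; have := ltn_ord k; lia.
by rewrite !mxE rev_ordK.
Qed.

Lemma psum_top_flat K v : flat v -> (K <= r)%N ->
  psum (top r K) v + psum (top r (r - K)) v = psum setT v.
Proof.
move=> v_flat le_K; have := psum_dual v le_K.
have -> : psum (top r K) (dual v) = - psum (top r K) v; last by lia.
rewrite /psum -sumrN; apply: eq_bigr => k _.
by rewrite !mxE (v_flat _ k).
Qed.

Lemma psum_sort v : psum setT (sort_vec v) = psum setT v.
Proof.
have [s es] := sort_vec_perm v.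
rewrite /psum [RHS](reindex_inj (@perm_inj _ s)) /=.
by apply: eq_big => k; rewrite ?inE // es.
Qed.

End PartialSums.

(** * Evacuation and the symmetry of the diagram *)

Section Evacuation.

Variable r : nat.
Implicit Types (T : seq 'rV[int]_r) (a b c d : signed_index r).

Section Oscillating.

Variables (t : nat) (T : seq 'rV[int]_r).
Hypothesis T_osc : oscillating t T.

Let D := pe_diagram T.

(** Sorting preserves the sum of the entries, so the local rule is additive on these sums. *)
Lemma osc_total i j : (i <= j <= t)%N ->
  psum setT (D i j) = psum setT T`_j - psum setT T`_i.
Proof.
elim: i j => [|i IH] j.
  by rewrite /D pe_diagram0; case: T_osc => _ _ -> _ _; rewrite psum0 subr0.
elim: j => [|j IHj] hj; first lia.
have [->|nij] := eqVneq i j; first by rewrite /D (osc_start T_osc) psum0 subrr.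
rewrite /D (osc_rule T_osc); last by lia.
by rewrite psum_sort !psumD psumN -/D !IH ?IHj; lia.
Qed.

Lemma nth_evacuation k : (k <= t)%N -> (evacuation T)`_k = D (t - k) t.
Proof.
move=> le_k; rewrite /evacuation (osc_length T_osc) (nth_map 0%N) ?size_iota //.
by rewrite nth_iota.
Qed.

Lemma osc_evacuation : oscillating t (evacuation T).
Proof.
split.
- by rewrite size_map size_iota (osc_length T_osc).
- by move=> k le_k; rewrite nth_evacuation //; apply: (osc_partition T_osc); lia.
- by rewrite nth_evacuation // subn0; apply: (osc_start T_osc).
- by rewrite nth_evacuation // subnn /D pe_diagram0; case: T_osc.
move=> k lt_k; rewrite !nth_evacuation; [|lia|lia].
have [|a ea] := @osc_vertical _ _ _ T_osc (t - k.+1) t; first by lia.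
by exists a; rewrite /D ea; congr (_ + _); congr (pe_diagram _ _ _); lia.
Qed.

(** The reflection exchanges the corner computed by the local rule with the opposite one, and by
    [osc_inverse_rule] the rule holds in this direction too. *)
Lemma evacuation_diagram i j : (i <= j <= t)%N ->
  pe_diagram (evacuation T) i j = D (t - j) (t - i).
Proof.
elim: i j => [|i IH] j.
  by move=> hj; rewrite pe_diagram0 nth_evacuation ?subn0 //; lia.
elim: j => [|j IHj] hj; first lia.
have [->|nij] := eqVneq i j.
  by rewrite /D (osc_start osc_evacuation) (osc_start T_osc).
rewrite (osc_rule osc_evacuation); last by lia.
rewrite !IH ?IHj; try lia.
have [m em] : exists m, m = (t - j.+1)%N by exists (t - j.+1)%N.
have [n en] : exists n, n = (t - i.+1)%N by exists (t - i.+1)%N.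
have -> : (t - j = m.+1)%N by lia.
have -> : (t - i = n.+1)%N by lia.
rewrite -em -en /D (@osc_inverse_rule _ _ _ T_osc m n); last by lia.
by [].
Qed.

End Oscillating.

Lemma osc_last_column t T i : oscillating t T -> (i <= t)%N ->
  pe_diagram T i t = T`_t + dual T`_i.
Proof.
move=> T_osc le_i; have E_osc := osc_evacuation T_osc.
have f_flat : flat T`_t by case: T_osc.
apply: psum_top_inj => K le_K; rewrite psumD psum_dual //.
have tot : psum setT (pe_diagram T i t) = psum setT T`_t - psum setT T`_i.
  by apply: (osc_total T_osc); rewrite le_i leqnn.
have topT : top r r = setT by apply/setP => k; rewrite !inE ltn_ord.
have top0 v : psum (top r 0) v = 0 by rewrite /psum big_pred0 // => k; rewrite !inE.
(* The bounds below need both [K] and [r - K] to be positive; for [K = 0] and [K = r] the total sums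
   suffice. *)
have [->|K_gt0] := posnP K; first by rewrite !top0 subn0 topT; lia.
have [eK|nK] := eqVneq K r; first by rewrite eK subnn top0 topT; lia.
have le1 := osc_top_bound T_osc le_i (K := K).
(* Passing to complements, the first [r - K] rows for the evacuation at [t - i] give the opposite
   inequality for the first [K] rows. *)
have le2 := osc_top_bound E_osc (leq_subr i t) (K := r - K).
rewrite !(nth_evacuation T_osc) ?leq_subr // subnn (subKn le_i) pe_diagram0 in le2.
rewrite (evacuation_diagram T_osc) in le2; last by lia.
rewrite subnn (subKn le_i) pe_diagram0 in le2.
have := psum_top_flat f_flat le_K.
move: le1 le2; rewrite !psum_window ?leq_subr // (subKn le_K).
by move=> le1 le2; have := le1 _; have := le2 _; lia.
Qed.

(** Both sides obey the same local rule, since sorting commutes with [dual] and with adding a flat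
    vector; they agree in column [t] and at the ends of the rows. *)
Lemma osc_symmetry t T i k : oscillating t T -> (k <= i <= t)%N ->
  pe_diagram T i (t + k) = T`_t + dual (pe_diagram T k i).
Proof.
move=> T_osc; have f_flat : flat T`_t by case: T_osc.
elim: k i => [|k IH] i hi.
  by rewrite addn0 pe_diagram0 osc_last_column.
elim: i hi => [|i IHi] hi; first by lia.
have [->|nki] := eqVneq k i.
  by rewrite addnC (osc_end T_osc) (osc_start T_osc) dual0 addr0.
rewrite addnS (osc_rule T_osc) ?(osc_rule T_osc (i := k)); try lia.
rewrite -addnS IHi ?IH; try lia.
rewrite dual_sort !dualD dualN -sort_vec_flatD //; congr sort_vec.
by apply/rowP => l; rewrite !mxE; lia.
Qed.

End Evacuation.


(** A discrete intermediate value theorem, for the vertical labels along a row. *)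
Lemma monotone_crossing (z : nat -> int) (x : int) p q :
  (forall j, (p <= j < q)%N -> z j <= z j.+1) -> z p <= x < z q -> (p <= q)%N ->
  exists2 j, (p <= j < q)%N & forall k, (p <= k < q)%N -> (z k <= x < z k.+1) = (k == j).
Proof.
move=> z_mono zx le_pq.
have mono j k : (p <= j <= k)%N -> (k <= q)%N -> z j <= z k.
  elim: k => [|k IH] hj le_k; first by (have -> : j = 0%N by lia).
  have [->//|le_jk] : j = k.+1 \/ (j <= k)%N by lia.
  have := z_mono k; have := IH; lia.
have [j hj ej] : exists2 j, (p <= j < q)%N & z j <= x < z j.+1.
  elim: q le_pq zx z_mono {mono} => [|q IH] le_pq zx z_mono.
    have ep : p = 0%N by lia.
    by move: zx; rewrite ep; lia.
  have [ep|lt_pq] : p = q.+1 \/ (p <= q)%N by lia.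
    by move: zx; rewrite ep; lia.
  have [lt_xq|le_qx] := ltP x (z q).
    have [||j hj ej] := IH lt_pq; first by lia.
      by move=> j hj; apply: z_mono; lia.
    by exists j => //; lia.
  by exists q; lia.
exists j => // k hk; apply/idP/eqP => [ek|-> //].
case: (ltngtP k j) => // h.
  have := mono k.+1 j; lia.
have := mono j.+1 k; lia.
Qed.

(** * Promotion matrices *)

Section Crossing.

Variable r : nat.
Implicit Types (a b c d : signed_index r).

Definition cross a b (i : nat) : bool :=
  [&& 0 < si_val a, 0 < si_val b & si_val a <= i%:Z < si_val b]
  || [&& si_val a < 0, si_val b < 0 & `|si_val b| <= i%:Z < `|si_val a|].

Lemma cross0 a b : cross a b 0 = false.
Proof. by rewrite /cross !si_valE; case: a b => [[] k] [[] l] /=; lia. Qed.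

(** For negative labels the condition on absolute values is the crossing of the threshold
    [- i - 1]. *)
Lemma crossE a b i : a.1 = b.1 ->
  cross a b i = (si_val a <= (if a.1 then - i%:Z - 1 else i%:Z) < si_val b).
Proof. by rewrite /cross !si_valE; case: a b => [[] k] [[] l] //= _; lia. Qed.

(** Nothing is crossed if the labels pass unchanged; otherwise the pair [c], [d] is [b], [a] or the
    opposite of [a], [b], and reversing the rows moves the crossing from [i] to [r - i]. *)
Lemma cross_rev mu a b c d i : square_rel mu a b c d -> (i <= r)%N ->
  cross (rev_index c) (rev_index d) (r - i) = cross a b i.
Proof.
case=> [b1 d1 cases _] le_i; move: b1 d1 cases.
case: a b c d => [x k] [y l] [z m] [w n] /= -> -> cases.
have hk := ltn_ord k; have hl := ltn_ord l; have hm := ltn_ord m.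
case: cases => [[[->] [->]]|[-> [->] [->] _]|[[-> ->] [->] _]].
- by rewrite !crossE //= !si_valE /=; case: (x); case: (z) => /=; lia.
- by rewrite !crossE //= !si_valE /=; case: (z) => /=; lia.
by rewrite !crossE //= !si_valE /=; case: (x) => /=; lia.
Qed.

(** This serves evacuation, which exchanges the horizontal and vertical sides of the squares. *)
Lemma cross_flip mu a b c d i : square_rel mu a b c d ->
  cross d c i = cross a b i.
Proof.
case=> [b1 d1 cases _]; move: b1 d1 cases.
case: a b c d => [x k] [y l] [z m] [w n] /= -> -> cases.
case: cases => [[[->] [->]]|[-> [->] [->] _]|[[-> ->] [->] _]].
- by rewrite !crossE //= !si_valE /=; case: (x); case: (z) => /=; lia.
- by rewrite !crossE //= !si_valE /=; case: (z) => /=; lia.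
by rewrite !crossE //= !si_valE /=; case: (x) => /=; lia.
Qed.

End Crossing.

Section PromotionMatrix.

Variable r : nat.
Implicit Types (T : seq 'rV[int]_r) (a b c d : signed_index r).

(** The labels in the definition are unique. As [u] and [v] count from 0, the two vertical labels
    are in columns [j] and [j.+1]. *)
Lemma in_prom_crossE t T u v j a b i : oscillating t T ->
  u <> v -> j = (if u < v then v else v + t)%N ->
  pe_diagram T u j = pe_diagram T u.+1 j + unit_step a ->
  pe_diagram T u j.+1 = pe_diagram T u.+1 j.+1 + unit_step b ->
  in_prom_matrix T u.+1 v.+1 i = cross a b i.
Proof.
move=> T_osc nuv ej ea eb; rewrite /in_prom_matrix eqSS (osc_length T_osc).
have -> : (u == v) = false by apply/eqP.
have -> : (if (u.+1 < v.+1)%N then v.+1 else (v.+1 + t)%N) = j.+1.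
  by rewrite ltnS ej addSn; case: ltnP.
rewrite -!pred_Sn ea eb; apply/existsP/idP => [[a' /existsP[b' /and3P[]]]|hab].
  by move=> /eqP/addrI/unit_step_inj <- /eqP/addrI/unit_step_inj <-.
by exists a; apply/existsP; exists b; rewrite !eqxx.
Qed.

Definition prom_rel t T (i : nat) (u v : 'I_t) :=
  in_prom_matrix T u.+1 v.+1 (if i == r then 0%N else i).

Lemma prom_rel_diag t T i (u : 'I_t) : prom_rel T i u u = (i == 0%N) || (i == r).
Proof. by rewrite /prom_rel /in_prom_matrix eqxx; case: (i == r); rewrite ?orbT ?orbF. Qed.

Lemma osc_prom_square t T (u v : 'I_t) : oscillating t T -> u != v ->
  exists j a b c d, j = (if u < v then v : nat else v + t)%N /\ square_at T u j a b c d.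
Proof.
move=> T_osc nuv; have nuv' : u <> v :> nat by move=> /val_inj/eqP; rewrite (negbTE nuv).
exists (if (u < v)%N then v : nat else v + t)%N.
have [|a [b [c [d sq]]]] := @osc_square _ _ _ T_osc u (if (u < v)%N then v : nat else v + t)%N.
  by have := ltn_ord u; have := ltn_ord v; case: (ltnP u v); lia.
by exists a, b, c, d.
Qed.

Lemma prom_rel_end t T i (u v : 'I_t) : oscillating t T ->
  (i == 0%N) || (i == r) -> prom_rel T i u v = (v == u).
Proof.
move=> T_osc hi; have [->|nvu] := eqVneq v u; first by rewrite prom_rel_diag.
rewrite eq_sym in nvu.
have [j [a [b [c [d [ej [ea _ _ eb _]]]]]]] := osc_prom_square T_osc nvu.
rewrite /prom_rel (in_prom_crossE _ T_osc _ ej ea eb); last first.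
  by move=> /val_inj/eqP; rewrite (negbTE nvu).
by case/orP: hi => /eqP ->; rewrite ?eqxx ?if_same cross0.
Qed.

(** For [u < v], the symmetry of the diagram carries the square in row [u] and column [v] to the one
    in row [v] and column [u + t], and its horizontal sides to vertical ones. *)
Lemma prom_rel_sym t T i (u v : 'I_t) : oscillating t T -> (i <= r)%N ->
  prom_rel T (r - i)%N v u = prom_rel T i u v.
Proof.
move=> T_osc le_i.
have [hi|hi] := boolP ((i == 0%N) || (i == r)).
  rewrite (prom_rel_end u v T_osc hi) (prom_rel_end v u T_osc) 1?eq_sym //.
  by case/orP: hi => /eqP ->; rewrite ?subn0 ?subnn eqxx ?orbT.
have ne1 : (i == r) = false by apply/negbTE; move: hi; rewrite negb_or => /andP[].
have ne2 : (r - i == r)%N = false by move: hi; lia.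
rewrite /prom_rel ne1 ne2.
have [<-|nuv] := eqVneq u v; first by rewrite /in_prom_matrix eqxx; move: hi; lia.
move: {hi ne1 ne2} i le_i => i le_i.
wlog lt_uv : u v i le_i nuv / (u < v)%N => [IH|].
  case: (ltngtP u v) => h; first exact: IH.
    by rewrite -IH ?subKn ?leq_subr // eq_sym.
  by rewrite (val_inj h) eqxx in nuv.
have nuv' : u <> v :> nat by lia.
have [j [a [b [c [d [ej [ea ec ed eb rel]]]]]]] := osc_prom_square T_osc nuv.
rewrite lt_uv in ej; subst j.
rewrite (@in_prom_crossE t T u v v a b i) ?lt_uv //.
rewrite (@in_prom_crossE t T v u (u + t)%N (rev_index c) (rev_index d)) //; last 4 first.
- by move=> /esym.
- by have -> : (v < u)%N = false by lia.
- rewrite addnC !(osc_symmetry T_osc); try by have := ltn_ord u; have := ltn_ord v; lia.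
  by rewrite ec dualD -!addrA dual_unit_rev addr0.
- rewrite addnC -addnS !(osc_symmetry T_osc); try by have := ltn_ord u; have := ltn_ord v; lia.
  by rewrite ed dualD -!addrA dual_unit_rev addr0.
exact: cross_rev rel le_i.
Qed.

Lemma prom_rel_fun t T i (u : 'I_t) : oscillating t T -> (i <= r)%N ->
  exists v, forall w, prom_rel T i u w = (w == v).
Proof.
move=> T_osc le_i; have [hi|hi] := boolP ((i == 0%N) || (i == r)).
  by exists u => w; rewrite prom_rel_end.
have [i_gt0 lt_ir] : (0 < i)%N /\ (i < r)%N by move: hi; lia.
have ut := ltn_ord u.
have [|a0 ea0] := @osc_vertical _ _ _ T_osc u u.+1; first by lia.
have [|a1 ea1] := @osc_vertical _ _ _ T_osc u (u + t); first by lia.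
pose z := vlabel T a0 u.
have z_start : z u.+1 = a0 by rewrite /z (vlabelP a0 ea0).
have z_end : z (u + t)%N = a1 by rewrite /z (vlabelP a0 ea1).
have z_sq j : (u < j < u + t)%N -> exists c d, square_at T u j (z j) (z j.+1) c d.
  by move=> hj; apply: (vlabel_square T_osc).
have z1 j : (u < j <= u + t)%N -> (z j).1 = a0.1.
  elim: j => [|j IH] hj; first lia.
  have [ej|lt_j] : nat_of_ord u = j \/ (u < j)%N by lia.
    by rewrite -ej z_start.
  have [|c [d [_ _ _ _ [-> _ _ _]]]] := z_sq j; first lia.
  by apply: IH; lia.
pose x : int := if a0.1 then - i%:Z - 1 else i%:Z.
(* A single cell added to 0 has label 1 or [-r], and a label that makes a partition flat is [r] or
   -1. The threshold of any [i] with [0 < i < r] lies in between. *)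
have x_range : si_val (z u.+1) <= x < si_val (z (u + t)%N).
  have r0 : (0 < r)%N by lia.
  have r1 : (r.-1 < r)%N by lia.
  have p0 : gen_partition (pe_diagram T u u.+1) by apply: (osc_partition T_osc); lia.
  have p1 : gen_partition (pe_diagram T u.+1 (u + t)).
    by apply: (osc_partition T_osc); lia.
  have f_flat : flat (pe_diagram T u (u + t)).
    by rewrite (osc_end T_osc); case: T_osc.
  have a11 : a1.1 = a0.1 by rewrite -z_end z1 //; lia.
  have e_flat k l : pe_diagram T u.+1 (u + t) 0 k + unit_step a1 0 k =
      pe_diagram T u.+1 (u + t) 0 l + unit_step a1 0 l.
    by have := f_flat k l; rewrite ea1 ![(_ + unit_step _) _ _]mxE.
  rewrite z_start z_end /x !si_valE a11.
  have := e_flat a1.2 (Ordinal r0); have := e_flat a1.2 (Ordinal r1).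
  have := p1 _ _ (leq0n a1.2 : (Ordinal r0 <= a1.2)%N).
  have le_a1 : (a1.2 <= Ordinal r1)%N by have := ltn_ord a1.2 => /=; lia.
  have := p1 _ _ le_a1.
  have le_a0 : (a0.2 <= Ordinal r1)%N by have := ltn_ord a0.2 => /=; lia.
  have := p0 _ _ le_a0; have := p0 _ _ (leq0n a0.2 : (Ordinal r0 <= a0.2)%N).
  rewrite ea0 (osc_start T_osc) !add0r !unit_stepE !eqxx a11 {x}.
  rewrite -!(inj_eq val_inj) /=.
  case: a0 a1 {ea0 ea1 z z_start z_end z_sq z1 p0 p1 f_flat e_flat a11 le_a0 le_a1} => [x k] [y l] /=.
  by have := ltn_ord k; have := ltn_ord l; case: x; do !case: eqP => ?; lia.
have [||j hj j_uniq] := @monotone_crossing (fun j => si_val (z j)) x u.+1 (u + t)%N _ x_range.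
- move=> j hj; have [c [d [_ _ _ _ rel]]] := z_sq j hj; exact: square_rel_le rel.
- by lia.
(* The columns from [t] on stand for the indices less than [u]. *)
have lt_w : ((if j < t then j else j - t) < t)%N by case: (ltnP j t); lia.
exists (Ordinal lt_w) => w.
have [->|nwu] := eqVneq w u.
  rewrite prom_rel_diag (negbTE hi); apply/esym/negbTE/eqP => /(congr1 val) /=.
  by case: (ltnP j t); lia.
have nuw : u <> w :> nat by move=> /val_inj e; rewrite e eqxx in nwu.
have wt := ltn_ord w.
pose k := (if u < w then w : nat else w + t)%N.
have hk : (u.+1 <= k < u + t)%N by rewrite /k; case: (ltnP u w); lia.
have [c [d [ea _ _ eb _]]] := z_sq k hk.
rewrite /prom_rel; have -> : (i == r) = false by apply/negbTE/eqP; lia.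
rewrite (in_prom_crossE _ T_osc nuw erefl ea eb) crossE ?z1 //; try lia.
rewrite -/x j_uniq // -(inj_eq val_inj) /= /k.
by case: (ltnP u w); case: (ltnP j t); lia.
Qed.

End PromotionMatrix.


(** * The permutations of an oscillating tableau, and their conjugation under promotion and
    evacuation *)

Section PromotionPermutations.

Variable r : nat.
Implicit Types (T : seq 'rV[int]_r) (a b c d : signed_index r).

(** By [prom_rel_sym] the converse relation is functional too, hence injectivity. *)
Lemma prom_rel_perm t T i : oscillating t T -> (i <= r)%N ->
  exists p : {perm 'I_t}, forall u v, prom_rel T i u v = (v == p u).
Proof.
move=> T_osc le_i.
pose f u := odflt u [pick v : 'I_t | prom_rel T i u v].
have fE u v : prom_rel T i u v = (v == f u).
  have [w ew] := prom_rel_fun u T_osc le_i.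
  rewrite /f; case: pickP => [x|/(_ w)]; last by rewrite ew eqxx.
  by rewrite ew => /eqP ->.
have f_inj : injective f.
  move=> u u' e; have le_ri := leq_subr i r.
  have [w ew] := prom_rel_fun (f u) T_osc le_ri.
  have h x : f x = f u -> x = w.
    by move=> ex; apply/eqP; rewrite -ew (prom_rel_sym _ _ T_osc le_i) fE ex.
  by rewrite (h u) // (h u').
by exists (perm f_inj) => u v; rewrite permE.
Qed.

Definition osc_perm t T i : {perm 'I_t} :=
  odflt 1%g [pick p : {perm 'I_t} | [forall u, forall v, prom_rel T i u v == (v == p u)]].

Lemma osc_permE t T i u v : oscillating t T -> (i <= r)%N ->
  prom_rel T i u v = (v == osc_perm t T i u).
Proof.
move=> T_osc le_i; have [p ep] := prom_rel_perm T_osc le_i.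
rewrite /osc_perm; case: pickP => [q /forallP/(_ u)/forallP/(_ v)/eqP //|/(_ p)].
by case/forallP => x; apply/forallP => y; rewrite ep.
Qed.

Lemma prom_osc_relE t T i (p : {perm 'I_t}) :
  (forall u v, prom_rel T i u v = (v == p u)) -> prom_osc i T =1 Some \o p.
Proof.
move=> ep u; rewrite /prom_osc /=.
have e w : ([set w : 'I_t | in_prom_matrix T u.+1 w.+1 (if i == r then 0%N else i)] == [set w])
    = (w == p u).
  have -> : [set w : 'I_t | in_prom_matrix T u.+1 w.+1 (if i == r then 0%N else i)] = [set p u].
    by apply/setP => v; rewrite !inE -ep.
  by rewrite eqEsubset sub1set inE sub1set inE eq_sym andbb.
case: pickP => [w|/(_ (p u))]; rewrite e ?eqxx // => /eqP ->.
by [].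
Qed.

Lemma osc_perm_inv t T i : oscillating t T -> (i <= r)%N ->
  osc_perm t T (r - i) = (osc_perm t T i)^-1%g.
Proof.
move=> T_osc le_i; apply/permP => u; apply/esym/eqP.
by rewrite -osc_permE ?leq_subr // (prom_rel_sym _ _ T_osc le_i) osc_permE // permKV.
Qed.

Section Promotion.

Variables (t : nat) (T : seq 'rV[int]_r).
Hypothesis T_osc : oscillating t T.

Lemma nth_promotion k : (k <= t)%N -> (promotion T)`_k = pe_diagram T 1 k.+1.
Proof.
move=> le_k; rewrite /promotion (osc_length T_osc) (nth_map 0%N) ?size_iota //.
by rewrite nth_iota.
Qed.

Lemma osc_promotion : oscillating t (promotion T).
Proof.
have e_last : (promotion T)`_t = T`_t.
  by rewrite nth_promotion // -(add1n t) (osc_end T_osc).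
split.
- by rewrite size_map size_iota (osc_length T_osc).
- by move=> k le_k; rewrite nth_promotion //; apply: (osc_partition T_osc); lia.
- by rewrite nth_promotion // (osc_start T_osc).
- by rewrite e_last; case: T_osc.
move=> k lt_k; rewrite !nth_promotion; [|lia|lia].
by apply: (osc_row_steps T_osc); lia.
Qed.

(** The rows from 1 on satisfy the same local rule with the same boundary values. *)
Lemma promotion_diagram i j : (i <= j <= i + t)%N ->
  pe_diagram (promotion T) i j = pe_diagram T i.+1 j.+1.
Proof.
have e_last : (promotion T)`_t = T`_t.
  by rewrite nth_promotion // -(add1n t) (osc_end T_osc).
elim: i j => [|i IH] j; first by move=> hj; rewrite pe_diagram0 nth_promotion.
elim: j => [|j IHj] hj; first lia.
have [->|nij] := eqVneq i j.
  by rewrite (osc_start osc_promotion) (osc_start T_osc).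
have [ej|njt] := eqVneq j (i + t)%N.
  by rewrite ej -!addSn (osc_end osc_promotion) (osc_end T_osc) e_last.
rewrite (osc_rule osc_promotion); last by lia.
rewrite !IH ?IHj; try lia.
by rewrite -(osc_rule T_osc) //; lia.
Qed.

Lemma prom_rel_promotion i (u v : 'I_t) : (i <= r)%N ->
  prom_rel (promotion T) i u v = prom_rel T i (ordS u) (ordS v).
Proof.
move=> le_i; have [->|nuv] := eqVneq u v; first by rewrite !prom_rel_diag.
wlog lt_uv : u v i le_i nuv / (u < v)%N => [IH|].
  case: (ltngtP u v) => h; first exact: IH.
    rewrite -(prom_rel_sym _ _ osc_promotion) // -(prom_rel_sym _ _ T_osc) //.
    by rewrite IH ?leq_subr // eq_sym.
  by rewrite (val_inj h) eqxx in nuv.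
have [j [a [b [c [d [ej [ea _ _ eb _]]]]]]] := osc_prom_square osc_promotion nuv.
rewrite lt_uv in ej; subst j; have vt := ltn_ord v.
rewrite /prom_rel (in_prom_crossE _ osc_promotion _ _ ea eb) ?lt_uv //; last by lia.
move: ea eb; rewrite !promotion_diagram; try lia.
move=> ea eb; apply/esym.
have u1 : ordS u = u.+1 :> nat by rewrite /= modn_small //; lia.
(* For the last index [v], the successor is 0, which precedes [ordS u]; its column is then [0 + t],
   again [v.+1]. *)
have [ev|nv] := eqVneq v.+1 t.
  have v1 : ordS v = 0 :> nat by rewrite /= ev modnn.
  apply: (in_prom_crossE (j := v.+1) _ T_osc); rewrite ?u1 ?v1 //.
have v1 : ordS v = v.+1 :> nat by rewrite /= modn_small //; lia.
by apply: (in_prom_crossE (j := v.+1) _ T_osc); rewrite ?u1 ?v1 ?ltnS ?lt_uv //; lia.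
Qed.

Lemma prom_rel_evacuation i (u v : 'I_t) : (i <= r)%N ->
  prom_rel (evacuation T) i u v = prom_rel T (r - i)%N (rev_ord u) (rev_ord v).
Proof.
have E_osc := osc_evacuation T_osc.
(* This brings in row [rev_ord v] and column [rev_ord u], the reflection of row [u] and column
   [v]. *)
move=> le_i; rewrite (prom_rel_sym _ _ T_osc) //.
have [->|nuv] := eqVneq u v; first by rewrite !prom_rel_diag.
wlog lt_uv : u v i le_i nuv / (u < v)%N => [IH|].
  case: (ltngtP u v) => h; first exact: IH.
    rewrite -(prom_rel_sym _ _ E_osc) // -(prom_rel_sym _ _ T_osc) //.
    by rewrite IH ?leq_subr // eq_sym.
  by rewrite (val_inj h) eqxx in nuv.
have nvu : rev_ord v != rev_ord u by rewrite (inj_eq rev_ord_inj) eq_sym.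
have [j [a [b [c [d [ej [ea ec ed eb rel]]]]]]] := osc_prom_square T_osc nvu.
have vt := ltn_ord v; have ut := ltn_ord u.
have lt_vu : (rev_ord v < rev_ord u)%N by rewrite /=; lia.
rewrite lt_vu in ej; subst j.
rewrite [RHS]/prom_rel (in_prom_crossE _ T_osc _ _ ea eb) ?lt_vu //; last by lia.
rewrite -(cross_flip _ rel) /prom_rel.
apply: (in_prom_crossE (j := v) _ E_osc); rewrite ?lt_uv //; first by lia.
- rewrite !(evacuation_diagram T_osc); try lia.
  have -> : (t - v = (rev_ord v).+1)%N by rewrite /=; lia.
  have -> : (t - u = (rev_ord u).+1)%N by rewrite /=; lia.
  by have -> : (t - u.+1 = rev_ord u)%N by [].
- rewrite !(evacuation_diagram T_osc); try lia.
  have -> : (t - u = (rev_ord u).+1)%N by rewrite /=; lia.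
  have -> : (t - u.+1 = rev_ord u)%N by [].
  by have -> : (t - v.+1 = rev_ord v)%N by [].
Qed.

End Promotion.

Lemma osc_iter_promotion t T m : oscillating t T -> oscillating t (iter m (@promotion r) T).
Proof. by move=> T_osc; elim: m => //= m; apply: osc_promotion. Qed.

Lemma iter_promotion_diagram t T m i j : oscillating t T -> (i <= j <= i + t)%N ->
  pe_diagram (iter m (@promotion r) T) i j = pe_diagram T (m + i) (m + j).
Proof.
move=> T_osc; elim: m i j => [//|m IH] i j hij /=.
rewrite (promotion_diagram (osc_iter_promotion m T_osc)) // IH; last by lia.
by rewrite !addnS.
Qed.

Lemma osc_perm_promotion t T m i : oscillating t T -> (i <= r)%N ->
  prom_osc i (iter m (@promotion r) T)
    =1 Some \o ((long_cycle t ^- m)%g \o osc_perm t T i \o (long_cycle t ^+ m)%g).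
Proof.
move=> T_osc le_i u.
have rel v w : prom_rel (iter m (@promotion r) T) i v w =
    (w == (long_cycle t ^+ m * osc_perm t T i * long_cycle t ^- m)%g v).
  rewrite permM permM -[w in RHS](permK (long_cycle t ^+ m)) (inj_eq perm_inj).
  rewrite -osc_permE //; elim: m v w => [|m IH] v w; first by rewrite expg0 !perm1.
  rewrite /= (prom_rel_promotion (osc_iter_promotion m T_osc)) // IH.
  by rewrite !expgS !permM !permE.
by rewrite (prom_osc_relE rel) /= !permM.
Qed.

Lemma osc_perm_evacuation t T i : oscillating t T -> (i <= r)%N ->
  prom_osc i (evacuation T) =1 Some \o (longest t \o osc_perm t T (r - i) \o longest t).
Proof.
move=> T_osc le_i u.
have rel v w : prom_rel (evacuation T) i v w =
    (w == (longest t * osc_perm t T (r - i) * longest t)%g v).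
  rewrite (prom_rel_evacuation T_osc) // osc_permE ?leq_subr // !permM !permE.
  by rewrite -(inj_eq rev_ord_inj) rev_ordK.
by rewrite (prom_osc_relE rel) /= !permM.
Qed.

End PromotionPermutations.


(** * Blocks of increasing steps, and oscillization *)

Section Blocks.

Variable r : nat.
Implicit Types (T : seq 'rV[int]_r) (f g : nat -> 'rV[int]_r) (s : nat -> signed_index r).

(** A path of single cells into which one step of constant sign is split by oscillization. *)
Definition block f p q : Prop :=
  exists s, (forall m, (p <= m < q)%N -> f m.+1 = f m + unit_step (s m)) /\
    (forall l m, (p <= l < m)%N -> (m < q)%N -> slt (s l) (s m)).

Lemma block_intro f s p q :
  (forall m, (p <= m < q)%N -> f m.+1 = f m + unit_step (s m)) ->
  (forall m, (p <= m)%N -> (m.+1 < q)%N -> slt (s m) (s m.+1)) -> block f p q.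
Proof.
move=> ef s_slt; exists s; split=> // l m hlm; elim: m hlm => [|m IH] hlm lt_mq; first lia.
have [->|lt_lm] : l = m \/ (l < m)%N by lia.
  by apply: s_slt; lia.
by apply: slt_trans (IH _ _) (s_slt _ _ _); lia.
Qed.

Lemma block_eq f g p q : (forall m, (p <= m <= q)%N -> f m = g m) -> block f p q -> block g p q.
Proof.
move=> efg [s [ef s_slt]]; exists s; split=> // m hm.
by rewrite -!efg ?ef //; lia.
Qed.

(** Invariant: the rearrangement fixes every row whose label is larger than all labels used so far,
    in particular the row of the next cell. *)
Lemma sort_path_perm f g s p q :
  (forall m, (p <= m < q)%N -> f m.+1 = f m + unit_step (s m)) ->
  (forall l m, (p <= l < m)%N -> (m < q)%N -> slt (s l) (s m)) ->
  gen_partition (g p) ->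
  (forall m, (p <= m < q)%N -> g m.+1 = sort_vec (g m + (f m.+1 - f m))) ->
  forall m, (p <= m <= q)%N ->
  exists2 x : 'S_r, forall k, g m 0 k = (g p + (f m - f p)) 0 (x k)
    & forall k, (forall l, (p <= l < m)%N -> slt (s l) ((s l).1, k)) -> x k = k.
Proof.
move=> ef s_slt g_part eg; elim=> [|m IH] hm.
  have -> : p = 0%N by lia.
  by exists 1%g => k; rewrite ?perm1 // subrr addr0.
have [ep|le_pm] : p = m.+1 \/ (p <= m)%N by lia.
  by rewrite -ep; exists 1%g => k; rewrite ?perm1 // subrr addr0.
have [|x ex fix_x] := IH; first by lia.
have gm_part : gen_partition (g m).
  have [->//|lt_pm] : m = p \/ (p < m)%N by lia.
  have -> : m = m.-1.+1 by lia.
  by rewrite eg; [apply: sort_vec_partition | lia].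
have efm : f m.+1 - f m = unit_step (s m) by rewrite ef; [rewrite addrC addKr | lia].
have [d [ed ed2 d1 le_d]] := sort_unit (s m) gm_part.
have x_sm : x (s m).2 = (s m).2.
  apply: fix_x => l hl; have h : slt (s l) (s m) by apply: s_slt; lia.
  by case/andP: (h) => /eqP -> _; rewrite -surjective_pairing.
exists (tperm d.2 (s m).2 * x)%g => k; last first.
  move=> hk; rewrite permM tpermD; first by apply: fix_x => l hl; apply: hk; lia.
    apply/eqP => ek; have /andP[_] : slt (s m) ((s m).1, k) by apply: hk; lia.
    by move: le_d; rewrite !si_valE -ek -d1 /=; lia.
  apply/eqP => ek; have : slt (s m) ((s m).1, k) by apply: hk; lia.
  by rewrite -ek -surjective_pairing slt_irr.
rewrite eg ?efm ?ed; last by lia.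
have -> : g p + (f m.+1 - f p) = g p + (f m - f p) + unit_step (s m).
  by rewrite -efm -[RHS]addrA (addrC (f m - f p)) subrKA.
have xE l : (g p + (f m - f p) + unit_step (s m)) 0 (x l) = (g m + unit_step (s m)) 0 l.
  by rewrite [LHS]add_unitE [RHS]add_unitE -ex -{1}x_sm (inj_eq perm_inj).
rewrite permM xE !add_unitE d1; case: tpermP => [->|->|/eqP/negPf-> /eqP/negPf->] //.
  by rewrite !eqxx ed2.
by rewrite ed2 eq_sym.
Qed.

(** Sorting after every cell amounts to sorting once at the end, and the cells stay increasing by
    [sort_unit2]. *)
Lemma sort_path f g p q : (p <= q)%N -> block f p q -> gen_partition (g p) ->
  (forall m, (p <= m < q)%N -> g m.+1 = sort_vec (g m + (f m.+1 - f m))) ->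
  block g p q /\ g q = sort_vec (g p + (f q - f p)).
Proof.
move=> le_pq [s [ef s_slt]] g_part eg.
have gm_part m : (p <= m <= q)%N -> gen_partition (g m).
  move=> hm; have [->//|lt_pm] : m = p \/ (p < m)%N by lia.
  have -> : m = m.-1.+1 by lia.
  by rewrite eg; [apply: sort_vec_partition | lia].
have efm m : (p <= m < q)%N -> f m.+1 - f m = unit_step (s m).
  by move=> hm; rewrite ef // addrC addKr.
split; last first.
  have [|x ex _] := sort_path_perm ef s_slt g_part eg (m := q); first by lia.
  by apply/esym/(@sort_vec_uniq _ _ _ x) => //; apply: gm_part; lia.
pose d m := odflt (s m) [pick d | g m.+1 == g m + unit_step d].
have dP m a : g m.+1 = g m + unit_step a -> d m = a.
  rewrite /d => ea; case: pickP => [b /eqP|/(_ a)]; last by rewrite ea eqxx.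
  by rewrite ea => /addrI/unit_step_inj.
apply: (@block_intro _ d) => [m hm|m le_pm lt_mq].
  have [|a [ea _ _ _]] := @sort_unit _ (g m) (s m); first by apply: gm_part; lia.
  have ea' : g m.+1 = g m + unit_step a by rewrite eg // efm // ea.
  by rewrite (dP _ _ ea').
have [||a [b [ab ea eb _]]] := @sort_unit2 _ (g m) (s m) (s m.+1).
- by apply: gm_part; lia.
- by apply: s_slt; lia.
have ea' : g m.+1 = g m + unit_step a by rewrite eg ?efm ?ea //; lia.
have eb' : g m.+2 = g m.+1 + unit_step b by rewrite eg ?efm ?ea' ?eb //; lia.
by rewrite (dP _ _ ea') (dP _ _ eb').
Qed.

Section OscillatingBlocks.

Variables (t : nat) (X : seq 'rV[int]_r).
Hypothesis X_osc : oscillating t X.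

Let D := pe_diagram X.

Lemma row_block_corner u p q : block (D 0) p q -> (u <= p <= q)%N -> (q <= t)%N ->
  block (D u) p q /\ ((u < p)%N -> D u.+1 q = sort_vec (D u.+1 p + (D u q - D u p))).
Proof.
move=> X_block hu le_qt.
have next v : block (D v) p q -> (v < p)%N ->
    block (D v.+1) p q /\ D v.+1 q = sort_vec (D v.+1 p + (D v q - D v p)).
  move=> v_block lt_vp; apply: sort_path => //; first by lia.
    by apply: (osc_partition X_osc); lia.
  move=> m hm; rewrite /D (osc_rule X_osc); last by lia.
  by rewrite addrAC [in RHS]addrC.
have b v : (v <= p)%N -> block (D v) p q.
  by elim: v => [//|v IH] lt_v; have [|] := next v _ lt_v; [apply: IH; lia|].
have le_up : (u <= p)%N by lia.
by split=> [|lt_u]; [apply: b | have [] := next u (b u le_up) lt_u].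
Qed.

Lemma row_block u p q : block (D 0) p q -> (u <= p <= q)%N -> (q <= t)%N -> block (D u) p q.
Proof. by move=> hb h1 h2; case: (row_block_corner hb h1 h2). Qed.

(** A block uses distinct rows, and row [p] starts with 0. In each square of the triangle the two
    labels in question sit in rows with entry 0, and sorting replaces the larger label by the
    smaller one, so each row copies the previous one. *)
Lemma triangle_diagram p q u v : block (D 0) p q -> (q <= t)%N -> (p <= u <= v)%N -> (v <= q)%N ->
  D u v = D p (p + (v - u)).
Proof.
move=> X_block le_qt; have [le_pq|lt_qp] := leqP p q; last by lia.
have [|s [es s_slt]] := row_block (u := p) X_block _ le_qt; first by lia.
have zero j k : (p + j <= q)%N -> (forall l, (p <= l < p + j)%N -> k != (s l).2) ->
    D p (p + j) 0 k = 0.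
  elim: j => [|j IH] le_j hk; first by rewrite addn0 /D (osc_start X_osc) mxE.
  rewrite addnS es ?add_unitE ?(negbTE (hk _ _)) ?addr0; try lia.
  by apply: IH => [|l hl]; [lia | apply: hk; lia].
have s_neq l m : (p <= l < m)%N -> (m < q)%N -> (s m).2 != (s l).2.
  move=> hl lt_m; have := s_slt l m hl lt_m; apply: contraTneq => e.
  rewrite /slt; case: eqP => //= e1.
  by rewrite [s l]surjective_pairing [s m]surjective_pairing e e1 ltxx.
elim: u v => [|u IH] v hu le_v; first by (have -> : p = 0%N by lia); rewrite subn0.
have [->|le_pu] : p = u.+1 \/ (p <= u)%N by lia.
  by congr (D _ _); lia.
have [->|lt_uv] : v = u.+1 \/ (u.+1 < v)%N by lia.
  by rewrite subnn addn0 /D !(osc_start X_osc).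
elim: v hu le_v lt_uv => [|v IHv] hu le_v lt_uv; first by lia.
rewrite {1}/D (osc_rule X_osc); last by lia.
rewrite -/D (IH v.+1) ?(IH v); try lia.
have -> : D u.+1 v = D p (p + (v - u.+1)).
  have [->|lt] : v = u.+1 \/ (u.+1 < v)%N by lia.
    by rewrite subnn addn0 /D !(osc_start X_osc).
  by apply: IHv; lia.
pose k := (v - u.+1)%N.
have -> : (v.+1 - u = k.+2)%N by rewrite /k; lia.
have -> : (v - u = k.+1)%N by rewrite /k; lia.
have -> : (v.+1 - u.+1 = k.+1)%N by rewrite /k; lia.
rewrite -/k !addnS.
have e1 : D p (p + k).+1 = D p (p + k) + unit_step (s (p + k)%N) by apply: es; rewrite /k; lia.
have e2 : D p (p + k).+2 = D p (p + k).+1 + unit_step (s (p + k).+1) by apply: es; rewrite /k; lia.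
have -> : D p (p + k).+2 + D p (p + k) - D p (p + k).+1 = D p (p + k) + unit_step (s (p + k).+1).
  by apply/eqP; rewrite subr_eq e2 addrC (addrC (D p (p + k).+1)) addrA.
have hk1 : (p <= p + k < (p + k).+1)%N by lia.
have hk2 : ((p + k).+1 < q)%N by rewrite /k; lia.
have /andP[/eqP s1 _] := s_slt _ _ hk1 hk2.
have ne := s_neq _ _ hk1 hk2.
apply: (@sort_vec_uniq _ _ _ (tperm (s (p + k)%N).2 (s (p + k).+1).2)).
  by apply: (osc_partition X_osc); rewrite /k; lia.
have z1 : D p (p + k) 0 (s (p + k)%N).2 = 0.
  by apply: zero => [|l hl]; [lia | apply: s_neq; lia].
have z2 : D p (p + k) 0 (s (p + k).+1).2 = 0.
  by apply: zero => [|l hl]; [lia | apply: s_neq; lia].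
move=> i; rewrite e1 !add_unitE s1; case: tpermP => [->|->|/eqP/negPf-> /eqP/negPf->] //.
  by rewrite !eqxx z1 z2.
by rewrite z1 z2 eq_sym.
Qed.

(** Column [q] is row [p] of the triangle read backwards with opposite labels, which increase again.
    Later columns follow from [sort_path], as the local rule is symmetric in both directions. *)
Lemma column_block v p q : block (D 0) p q -> (p <= q <= v)%N -> (v <= t)%N ->
  block (fun m => D m v) p q.
Proof.
move=> X_block; elim: v => [|v IH] hq le_vt.
  have [s [es s_slt]] := X_block.
  by exists s; split=> m; lia.
have [eq_v|le_qv] : q = v.+1 \/ (q <= v)%N by lia.
  rewrite -eq_v in le_vt *.
  have [|s [es s_slt]] := row_block (u := p) X_block _ le_vt; first by lia.
  apply: (@block_intro _ (fun m => opp_index (s (p + q - m).-1))).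
    move=> m hm; rewrite (@triangle_diagram p q m.+1 q) ?(@triangle_diagram p q m q) //; try lia.
    rewrite -opp_unit; apply/eqP; rewrite -subr_eq opprK; apply/eqP/esym.
    have -> : (p + (q - m) = (p + q - m).-1.+1)%N by lia.
    have -> : (p + (q - m.+1) = (p + q - m).-1)%N by lia.
    by apply: es; lia.
  by move=> m le_pm lt_mq; rewrite slt_opp; apply: s_slt; lia.
have [] // := @sort_path (fun m => D m v) (fun m => D m v.+1) p q; first by lia.
- by apply: IH; lia.
- by apply: (osc_partition X_osc); lia.
by move=> m hm; rewrite /D (osc_rule X_osc) ?addrA //; lia.
Qed.

Lemma block_corner p q p' q' : block (D 0) p q -> block (D 0) p' q' ->
  (p <= q <= p')%N -> (p' <= q' <= t)%N ->
  D q q' = sort_vec (D p q' + D q p' - D p p').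
Proof.
move=> b1 b2 h1 h2.
have [] := @sort_path (fun m => D m p') (fun m => D m q') p q; first by lia.
- by apply: (column_block b1); lia.
- by apply: (osc_partition X_osc); lia.
- move=> m hm; have [||_ ->] := row_block_corner (u := m) b2; try lia.
  by rewrite addrCA.
by move=> _ ->; rewrite addrA.
Qed.

End OscillatingBlocks.

End Blocks.


(** * Recovering a path of cells from the ends of its blocks *)

Section Standardization.

Variable r : nat.
Implicit Types (T : seq 'rV[int]_r) (f g : nat -> 'rV[int]_r) (S : {set signed_index r}).

Lemma set_stepE S k : set_step S 0 k = ((false, k) \in S)%:Z - ((true, k) \in S)%:Z.
Proof.
rewrite /set_step summxE (eq_bigr _ (fun s _ => unit_stepE s k)) -big_mkcondr /=.
rewrite (bigID (fun s => s.1)) /= addrC; congr (_ + _).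
  rewrite (eq_bigr (fun=> 1)); last by move=> s /andP[_ /negbTE ->].
  have [h|h] := boolP (_ \in S).
    rewrite (big_pred1 (false, k)) // => -[x i] /=; rewrite xpair_eqE.
    by case: x; rewrite ?andbF //= andbT eq_sym; case: eqP => [->|]; rewrite ?h ?andbF.
  rewrite big_pred0 // => -[x i] /=.
  by case: x; rewrite ?andbF //= andbT; case: eqP => [<-|]; rewrite ?(negbTE h) ?andbF.
rewrite (eq_bigr (fun=> -1)); last by move=> s /andP[_ ->].
have [h|h] := boolP (_ \in S).
  rewrite (big_pred1 (true, k)) // => -[x i] /=; rewrite xpair_eqE.
  by case: x; rewrite ?andbF //= andbT eq_sym; case: eqP => [->|]; rewrite ?h ?andbF.
rewrite big_pred0 ?oppr0 // => -[x i] /=.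
by case: x; rewrite ?andbF //= andbT; case: eqP => [<-|]; rewrite ?(negbTE h) ?andbF.
Qed.

Lemma same_signP S : reflect (forall s s', s \in S -> s' \in S -> s.1 = s'.1) (same_sign S).
Proof.
apply: (iffP forall_inP) => [h s s' hs hs'|h s hs].
  by apply/eqP; move: (h s hs) => /forall_inP; apply.
by apply/forall_inP => s' hs'; apply/eqP; apply: h.
Qed.

Lemma set_step_inj S S' : same_sign S -> same_sign S' -> set_step S = set_step S' -> S = S'.
Proof.
move=> /same_signP hS /same_signP hS' e; apply/setP => -[x k].
have := set_stepE S k; rewrite e set_stepE.
have := hS (false, k) (true, k); have := hS' (false, k) (true, k).
by case: x; case: ((false, k) \in S); case: ((true, k) \in S);
  case: ((false, k) \in S'); case: ((true, k) \in S') => h1 h2 //;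
  try (by have := h1 isT isT); try (by have := h2 isT isT).
Qed.

Definition step_seq S := sort (fun s s' : signed_index r => si_val s <= si_val s') (enum S).

Lemma mem_step_seq S : step_seq S =i S.
Proof. by move=> s; rewrite mem_sort mem_enum. Qed.

Lemma step_seq_uniq S : uniq (step_seq S).
Proof. by rewrite sort_uniq enum_uniq. Qed.

Lemma step_seq_eq S (L : seq (signed_index r)) :
  uniq L -> L =i S -> sorted (fun s s' => si_val s <= si_val s') L -> step_seq S = L.
Proof.
move=> L_uniq eLS L_sorted; apply: sorted_eq L_sorted _.
- by move=> x y z; apply: le_trans.
- by move=> x y /le_anti/si_val_inj.
- by apply: sort_sorted => x y; apply: le_total.
apply: uniq_perm => //; first exact: step_seq_uniq.
by move=> s; rewrite mem_step_seq eLS.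
Qed.

Lemma set_step_seq S (L : seq (signed_index r)) : uniq L -> L =i S ->
  set_step S = \sum_(s <- L) unit_step s.
Proof. by move=> L_uniq eLS; rewrite big_uniq //; apply: eq_bigl => s; rewrite -eLS. Qed.

Lemma step_set_eq (v : 'rV[int]_r) S : same_sign S -> step_set v (v + set_step S) = S.
Proof.
move=> hS; rewrite /step_set; case: pickP => [S' /andP[hS' /eqP/addrI e]|/(_ S)].
  by rewrite /= (set_step_inj hS hS' e).
by rewrite hS eqxx.
Qed.

(** A block lists the elements of its step set in increasing order, and such a list is unique. *)
Lemma std_step_block f p q : (p <= q)%N -> block f p q ->
  std_step (f p) (f q) = [seq f m | m <- iota p.+1 (q - p)].
Proof.
move=> le_pq [s [ef s_slt]]; pose L := [seq s m | m <- iota p (q - p)].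
have scan v m n : v = f m -> (p <= m)%N -> (m + n <= q)%N ->
    scanl (fun v s => v + unit_step s) v [seq s m | m <- iota m n] = [seq f m | m <- iota m.+1 n].
  move=> ->; elim: n m => [//|n IH] m le_pm le_q /=.
  by rewrite -ef; [rewrite IH //; lia | lia].
have sum_L n : (p + n <= q)%N -> f (p + n)%N = f p + \sum_(x <- [seq s m | m <- iota p n]) unit_step x.
  elim: n => [|n IH] le_n; first by rewrite addn0 big_nil addr0.
  rewrite addnS ef ?IH; try lia.
  by rewrite -(addn1 n) iotaD map_cat big_cat big_seq1 addrA.
have L_sorted : sorted (@slt r) L.
  apply/(sortedP (s p)) => i; rewrite size_map size_iota => hi.
  by rewrite !(nth_map 0%N) ?size_iota ?nth_iota; try lia; apply: s_slt; lia.
have L_uniq : uniq L by apply: sorted_uniq L_sorted; [exact: slt_trans | exact: slt_irr].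
pose S : {set signed_index r} := [set x in L].
have eLS : L =i S by move=> x; rewrite inE.
have hS : same_sign S.
  apply/same_signP => x y; rewrite !inE => /mapP[l hl ->] /mapP[m hm ->].
  rewrite !mem_iota in hl hm.
  case: (ltngtP l m) => [lt_lm|lt_ml|-> //].
    by have /andP[/eqP] : slt (s l) (s m) by apply: s_slt; lia.
  by have /andP[/eqP] : slt (s m) (s l) by apply: s_slt; lia.
have eq_q : f q = f p + set_step S.
  rewrite (set_step_seq L_uniq eLS); have := sum_L (q - p)%N; rewrite subnKC //.
  exact.
rewrite /std_step {1}eq_q (step_set_eq _ hS) -/(step_seq S) (step_seq_eq L_uniq eLS).
  by apply: scan => //; lia.
by apply: sub_sorted L_sorted => x y /andP[_ /ltW].
Qed.

(** [N] gives the block boundaries; equal consecutive values are empty steps, which standardization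
    deletes. *)
Lemma std_blocks f (N : nat -> nat) n :
  N 0%N = 0%N -> (forall k, (k < n)%N -> (N k <= N k.+1)%N /\ block f (N k) (N k.+1)) ->
  std (mkseq (f \o N) n.+1) = mkseq f (N n).+1.
Proof.
move=> N0 hN; rewrite /mkseq /= N0; congr cons.
have N_mono k m : (k + m <= n)%N -> (N k <= N (k + m))%N.
  elim: m => [|m IH] h; first by rewrite addn0.
  have [|le_N _] := hN (k + m)%N; first by lia.
  by rewrite addnS; apply: leq_trans le_N; apply: IH; lia.
have gen k m : (k + m <= n)%N ->
    flatten (pairmap (@std_step r) (f (N k)) [seq (f \o N) i | i <- iota k.+1 m])
    = [seq f i | i <- iota (N k).+1 (N (k + m) - N k)%N].
  elim: m k => [|m IH] k h; first by rewrite addn0 subnn.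
  have [|le_N b] := hN k; first by lia.
  rewrite /= std_step_block // IH; last by lia.
  rewrite addSnnS -map_cat; congr map.
  have := N_mono k.+1 m; rewrite addSnnS => hm.
  have -> : (N (k + m.+1) - N k = (N k.+1 - N k) + (N (k + m.+1) - N k.+1))%N by lia.
  by rewrite iotaD; congr (_ ++ iota _ _); lia.
by have := gen 0%N n; rewrite N0 add0n subn0; apply.
Qed.

Definition cum (c : seq int) k := (\sum_(x <- take k c) `|x|)%N.

Lemma cum0 c : cum c 0 = 0%N.
Proof. by rewrite /cum take0 big_nil. Qed.

Lemma cum_size c : cum c (size c) = (\sum_(x <- c) `|x|)%N.
Proof. by rewrite /cum take_size. Qed.

Lemma cum_cons x c k : cum (x :: c) k.+1 = (`|x| + cum c k)%N.
Proof. by rewrite /cum /= big_cons. Qed.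

Lemma sum_unitE (L : seq (signed_index r)) k : uniq L ->
  (\sum_(s <- L) unit_step s) 0 k = ((false, k) \in L)%:Z - ((true, k) \in L)%:Z.
Proof.
move=> L_uniq; have e : L =i [set x in L] by move=> x; rewrite inE.
by rewrite -(set_step_seq L_uniq e) set_stepE !inE.
Qed.

(** An inequality violated after [U] would have to be repaired by a label of [V] that is smaller
    than the label of [U] that caused the violation. *)
Lemma partial_step_partition (v : 'rV[int]_r) (U V : seq (signed_index r)) b :
  uniq (U ++ V) -> (forall s, s \in U ++ V -> s.1 = b) ->
  (forall s s', s \in U -> s' \in V -> si_val s < si_val s') ->
  gen_partition v -> gen_partition (v + \sum_(s <- U ++ V) unit_step s) ->
  gen_partition (v + \sum_(s <- U) unit_step s).
Proof.
move=> UV_uniq UV_sign UV_lt v_part w_part i j le_ij.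
have := w_part _ _ le_ij; have := v_part _ _ le_ij.
have U_uniq : uniq U by move: UV_uniq; rewrite cat_uniq => /andP[].
rewrite !mxE !sum_unitE // !mem_cat.
have nU k : ((~~ b, k) \in U) = false.
  by apply/negP => h; have := UV_sign (~~ b, k); rewrite mem_cat h => /(_ isT); case: (b).
have nV k : ((~~ b, k) \in V) = false.
  apply/negP => h; have := UV_sign (~~ b, k).
  by rewrite mem_cat h orbT => /(_ isT); case: (b).
have ltUV x y : (b, x) \in U -> (b, y) \in V -> si_val (b, x) < si_val (b, y).
  exact: UV_lt.
have := ltUV i j; have := ltUV j i; rewrite !si_valE /= {ltUV UV_lt}.
case: b nU nV {UV_sign} => /= nU nV; rewrite !nU !nV /=.
  by case: ((true, i) \in U) => /=; case: ((true, j) \in U) => /=;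
    case: ((true, i) \in V) => /=; case: ((true, j) \in V) => /=; lia.
by case: ((false, i) \in U) => /=; case: ((false, j) \in U) => /=;
  case: ((false, i) \in V) => /=; case: ((false, j) \in V) => /=; lia.
Qed.

End Standardization.


(** * Oscillization commutes with evacuation, and turns promotion into iterated promotion *)

Section Oscillization.

Variable r : nat.
Implicit Types (T : seq 'rV[int]_r) (f g : nat -> 'rV[int]_r) (S : {set signed_index r}).

Lemma block_shift f g p q d : block f p q ->
  (forall m, (p <= m <= q)%N -> g (d + m)%N = f m) -> block g (d + p) (d + q).
Proof.
move=> [s [ef s_slt]] egf; exists (fun m => s (m - d)%N); split=> [m hm|l m hl hm].
  have em : m = (d + (m - d))%N by lia.
  by rewrite em -addnS !egf ?ef ?addKn //; lia.
by apply: s_slt; lia.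
Qed.

Lemma block_rev f p q t : (q <= t)%N -> block f p q ->
  block (fun m => f (t - m)%N) (t - q) (t - p).
Proof.
move=> le_qt [s [ef s_slt]]; exists (fun m => opp_index (s (t - m).-1)).
split=> [m hm|l m hl hm]; last by rewrite slt_opp; apply: s_slt; lia.
have e : (t - m = (t - m).-1.+1)%N by lia.
rewrite -opp_unit {1}e ef; last by lia.
by rewrite addrK; congr f; lia.
Qed.

Lemma block_dual f p q v : block f p q -> block (fun m => v + dual (f m)) p q.
Proof.
move=> [s [ef s_slt]]; exists (fun m => dual_index (s m)).
split=> [m hm|l m hl hm]; last by rewrite slt_dual; apply: s_slt.
by rewrite ef // dualD dual_unit addrA.
Qed.

Lemma cumS c k : (k < size c)%N -> cum c k.+1 = (cum c k + `|(c`_k)%R|)%N.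
Proof. by move=> hk; rewrite /cum (take_nth 0) // -cats1 big_cat big_seq1. Qed.

Lemma cum_mono c j k : (j <= k <= size c)%N -> (cum c j <= cum c k)%N.
Proof.
elim: k => [|k IH] hj; first by have -> : j = 0%N by lia.
have [->//|le_jk] : j = k.+1 \/ (j <= k)%N by lia.
by rewrite cumS; [apply: leq_trans (leq_addr _ _); apply: IH; lia | lia].
Qed.

Lemma absz_step_type S : `|step_type S|%N = #|S|.
Proof. by rewrite /step_type; case: ifP => _; rewrite ?abszN. Qed.

Lemma size_step_seq S : size (step_seq S) = #|S|.
Proof. by rewrite size_sort -cardE. Qed.

Lemma oscillization (a0 : signed_index r) c T : fluctuating_tableau c T ->
  exists f, [/\ forall k, (k <= size c)%N -> f (cum c k) = T`_k,
    forall k, (k < size c)%N -> block f (cum c k) (cum c k.+1)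
    & forall m, (m <= cum c (size c))%N -> gen_partition (f m)].
Proof.
elim: c T => [|x c IH] T [sT T_part T_step].
  exists (fun=> T`_0); split=> //; first by case.
  by move=> m _; apply: T_part; rewrite sT.
case: T sT T_part T_step => [//|lam T] [sT] T_part T_step.
have [|g [g_eq g_block g_part]] := IH T.
  split=> // k hk; first exact: (T_part k.+1).
  exact: (T_step k.+1).
have [S [/same_signP hS /= emu ex]] := T_step 0%N isT.
rewrite /= in ex; pose L := step_seq S.
have sL : size L = `|x|%N by rewrite size_step_seq ex absz_step_type.
have L_sum : set_step S = \sum_(s <- L) unit_step s.
  by apply: set_step_seq; [apply: step_seq_uniq | apply: mem_step_seq].
(* The cells of the first step, followed by the path of the remaining tableau. *)
pose f m := if (m < `|x|)%N then lam + \sum_(s <- take m L) unit_step s else g (m - `|x|)%N.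
have g0 : g 0%N = T`_0 by rewrite -(g_eq 0%N) // cum0.
have fE m : (m <= `|x|)%N -> f m = lam + \sum_(s <- take m L) unit_step s.
  rewrite /f leq_eqVlt => /orP[/eqP ->|-> //].
  by rewrite ltnn subnn g0 emu L_sum -sL take_size.
have fD m : f (`|x| + m)%N = g m.
  by rewrite /f ltnNge leq_addr /= addKn.
have f0 : f 0%N = lam by rewrite fE // take0 big_nil addr0.
have L_slt l m : (l < m)%N -> (m < size L)%N -> slt (nth a0 L l) (nth a0 L m).
  move=> lt_lm lt_m; have lt_l := ltn_trans lt_lm lt_m.
  rewrite /slt (hS (nth a0 L l) (nth a0 L m)) -?mem_step_seq ?mem_nth // eqxx /=.
  rewrite lt_neqAle; apply/andP; split.
    apply/negP => /eqP/si_val_inj/eqP; rewrite nth_uniq ?step_seq_uniq //; lia.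
  apply: (@sorted_leq_nth _ (fun s s' => si_val s <= si_val s')) => //.
  - by move=> u v w; apply: le_trans.
  - by apply: sort_sorted => u v; apply: le_total.
  - exact: ltnW.
exists f; split.
- case=> [|k] hk; first by rewrite cum0 f0.
  by rewrite cum_cons fD g_eq.
- case=> [|k] hk; last first.
    by rewrite !cum_cons; apply: (block_shift (g_block k hk)).
  rewrite cum0 cum_cons cum0 addn0; exists (nth a0 L); split.
    move=> m hm; rewrite !fE; [|lia|lia].
    by rewrite (take_nth a0) ?sL; [rewrite -cats1 big_cat big_seq1 addrA | lia].
  by move=> l m hl hm; apply: L_slt; rewrite ?sL; lia.
move=> m; rewrite /= cum_cons => hm; have [le_xm|lt_mx] := leqP `|x| m.
  have -> : m = (`|x| + (m - `|x|))%N by lia.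
  by rewrite fD; apply: g_part; lia.
rewrite fE; last by lia.
apply: (@partial_step_partition _ _ _ (drop m L) (nth a0 L 0).1); rewrite ?cat_take_drop.
- exact: step_seq_uniq.
- move=> s hs; apply: hS; rewrite -mem_step_seq //.
  by apply: mem_nth; rewrite sL; lia.
- move=> s s' /(nthP a0)[l]; rewrite size_takel; last by rewrite sL; lia.
  move=> hl <- /(nthP a0)[l']; rewrite size_drop sL => hl' <-.
  rewrite nth_take // nth_drop.
  have /andP[_ //] : slt (nth a0 L l) (nth a0 L (m + l')%N).
  by apply: L_slt; rewrite ?sL; lia.
- exact: (T_part 0%N).
by rewrite -L_sum -emu; apply: (T_part 1%N); rewrite /= sT.
Qed.

Section Std.

Variables (c : seq int) (T : seq 'rV[int]_r) (f : nat -> 'rV[int]_r).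
Hypotheses (T_tab : fluctuating_tableau c T) (T_rect : rectangular T).
Hypothesis f_eq : forall k, (k <= size c)%N -> f (cum c k) = T`_k.
Hypothesis f_block : forall k, (k < size c)%N -> block f (cum c k) (cum c k.+1).
Hypothesis f_part : forall m, (m <= cum c (size c))%N -> gen_partition (f m).

Let n := size c.
Let t := cum c n.
Let X := mkseq f t.+1.
Let D := pe_diagram X.

Lemma tab_length_size : tab_length T = n.
Proof. by case: T_tab => sT _ _; rewrite /tab_length sT. Qed.

Lemma osc_mkseq : oscillating t X.
Proof.
case: T_tab => sT T_part _; case: T_rect => T0 T_last.
have fX m : (m <= t)%N -> X`_m = f m by move=> hm; rewrite nth_mkseq.
split.
- by rewrite size_mkseq.
- by move=> k hk; rewrite fX //; apply: f_part.
- by rewrite fX //; have := f_eq (leq0n _); rewrite cum0 => ->.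
- move=> i j; rewrite fX // f_eq //; have := T_last i j.
  by rewrite -nth_last sT.
move=> m hm; rewrite !fX //; last by lia.
have steps k : (k <= n)%N -> forall m, (m < cum c k)%N -> exists a, f m.+1 = f m + unit_step a.
  elim: k => [|k IH] hk l; first by rewrite cum0.
  have [lt_l _|le_l lt_l] := ltnP l (cum c k); first by apply: IH => //; lia.
  by have [s [es _]] := f_block hk; exists (s l); apply: es; lia.
exact: (steps n).
Qed.

Lemma std_mkseq : std T = X.
Proof.
have -> : T = mkseq (f \o cum c) n.+1.
  apply: (@eq_from_nth _ 0); first by rewrite size_mkseq; case: T_tab.
  move=> k; have [-> _ _] := T_tab; move=> hk.
  by rewrite nth_mkseq //= f_eq.
apply: std_blocks; first exact: cum0.
by move=> k hk; split; [apply: cum_mono; rewrite -/n; lia | apply: f_block].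
Qed.

Lemma row0_block k : (k < n)%N -> block (D 0) (cum c k) (cum c k.+1).
Proof.
move=> hk; apply: (block_eq _ (f_block hk)) => m hm; rewrite /D pe_diagram0 nth_mkseq //.
have : (cum c k.+1 <= t)%N by apply: cum_mono; rewrite -/n; lia.
by lia.
Qed.

(** [block_corner] is the local rule for a pair of whole steps, so the diagram of [T] samples that
    of [X] at the block boundaries. *)
Lemma diagram_mkseq i j : (i <= j <= n)%N -> pe_diagram T i j = D (cum c i) (cum c j).
Proof.
have X_osc := osc_mkseq.
elim: i j => [|i IH] j hj.
  have le_t : (cum c j <= t)%N by apply: cum_mono; rewrite -/n; lia.
  by rewrite cum0 /D !pe_diagram0 nth_mkseq ?f_eq.
elim: j hj => [|j IHj] hj; first lia.
have [->|nij] := eqVneq i j.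
  by rewrite /D (osc_start X_osc) pe_diagram_start; case: T_rect.
rewrite pe_diagram_rule ?tab_length_size; last by lia.
rewrite !IH ?IHj; try lia.
apply/esym; apply: (block_corner X_osc); try by apply: row0_block; lia.
  by apply/andP; split; apply: cum_mono; rewrite -/n; lia.
by apply/andP; split; apply: cum_mono; rewrite -/n; lia.
Qed.

(** The steps of the evacuation are column blocks of column [t], read upwards. *)
Lemma std_evacuation : std (evacuation T) = evacuation X.
Proof.
have X_osc := osc_mkseq.
pose g m := D (t - m) t; pose N k := (t - cum c (n - k))%N.
have -> : evacuation X = mkseq g (N n).+1.
  rewrite /N subnn cum0 subn0; apply: (@eq_from_nth _ 0).
    by rewrite size_mkseq; case: (osc_evacuation X_osc).
  case: (osc_evacuation X_osc) => -> _ _ _ _ m hm.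
  by rewrite (nth_evacuation X_osc) // nth_mkseq.
have -> : evacuation T = mkseq (g \o N) n.+1.
  apply: (@eq_from_nth _ 0); rewrite /evacuation tab_length_size !size_map !size_iota // => k hk.
  rewrite !(nth_map 0%N) ?size_iota // nth_iota //= add0n diagram_mkseq; last by lia.
  by rewrite /g /N subKn //; apply: cum_mono; rewrite -/n; lia.
apply: std_blocks; first by rewrite /N subn0 subnn.
move=> k hk; have le_cum : (cum c (n - k.+1) <= cum c (n - k))%N.
  by apply: cum_mono; rewrite -/n; lia.
split; first by rewrite /N; lia.
have le_t : (cum c (n - k) <= t)%N by apply: cum_mono; rewrite -/n; lia.
apply: (block_rev (f := fun m => D m t)) => //.
have e : (n - k = (n - k.+1).+1)%N by lia.
have b : block (D 0) (cum c (n - k.+1)) (cum c (n - k)).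
  by rewrite e; apply: row0_block; lia.
by apply: (column_block X_osc b); rewrite ?le_cum.
Qed.

Lemma std_promotion : std (promotion T) = iter (absz c`_0) (@promotion r) X.
Proof.
have X_osc := osc_mkseq; have T0 : T`_0 = 0 by case: T_rect.
(* In length 0 promotion does nothing, and the default entry of [c] is 0. *)
have [n0|n_gt0] := posnP n.
  have sT : size T = 1%N by case: T_tab => ->; rewrite -/n n0.
  have -> : promotion T = T.
    rewrite /promotion /tab_length sT /= pe_diagram_start.
    by case: T sT => [//|x []].
  by rewrite std_mkseq (nth_default 0) // -/n n0.
pose p := `|(c`_0)%R|%N.
have e1 : cum c 1 = p by rewrite cumS // cum0.
have le_pt : (p <= t)%N by rewrite -e1; apply: cum_mono; rewrite -/n; lia.
have P_osc := osc_iter_promotion p X_osc.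
pose g m := D p (p + m).
(* Positions are counted from column [p], where row [p] starts; the last one is column [p + t]. *)
pose N k := if (k < n)%N then (cum c k.+1 - p)%N else t.
have -> : iter p (@promotion r) X = mkseq g (N n).+1.
  rewrite /N ltnn; apply: (@eq_from_nth _ 0).
    by rewrite size_mkseq; case: P_osc.
  case: (P_osc) => -> _ _ _ _ m hm.
  rewrite -pe_diagram0 (iter_promotion_diagram _ X_osc); last by lia.
  by rewrite nth_mkseq // addn0.
have -> : promotion T = mkseq (g \o N) n.+1.
  apply: (@eq_from_nth _ 0); rewrite /promotion tab_length_size !size_map !size_iota // => k hk.
  rewrite !(nth_map 0%N) ?size_iota // !nth_iota //= add0n /g /N.
  case: ltnP => [lt_kn|le_nk].
    have le_k : (1 <= k.+1 <= n)%N by lia.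
    rewrite add1n (diagram_mkseq le_k) e1.
    by rewrite subnKC // -e1; apply: cum_mono; rewrite -/n; lia.
  have -> : k = n by lia.
  rewrite -{1}tab_length_size pe_diagram_end tab_length_size /D (osc_end X_osc).
  by rewrite nth_mkseq // f_eq.
have N0 : N 0%N = 0%N by rewrite /N n_gt0 e1 subnn.
apply: std_blocks => // k hk.
have le_pk : (p <= cum c k.+1)%N by rewrite -e1; apply: cum_mono; rewrite -/n; lia.
have [lt_kn|le_nk] := ltnP k.+1 n.
  have le_cum : (cum c k.+1 <= cum c k.+2)%N by apply: cum_mono; rewrite -/n; lia.
  have le_t : (cum c k.+2 <= t)%N by apply: cum_mono; rewrite -/n; lia.
  rewrite /N hk lt_kn; split; first by lia.
  have b : block (D p) (cum c k.+1) (cum c k.+2).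
    by apply: (row_block X_osc (row0_block lt_kn)); rewrite ?le_pk.
  have [s [es s_slt]] := b; exists (fun m => s (p + m)%N).
  by split=> [m hm|l m hl hm]; rewrite /g; [rewrite addnS es //; lia | apply: s_slt; lia].
have ek : k.+1 = n by lia.
rewrite /N hk ek ltnn -/t; split; first by lia.
(* The last block lies in columns [t] to [t + p]; by the symmetry it is dual to the column block of
   the first step in column [p]. *)
have b : block (fun m => X`_t + dual (D m p)) 0 p.
  apply: block_dual; apply: (column_block X_osc) => //; last by lia.
  by have := row0_block n_gt0; rewrite cum0 e1.
have := @block_shift _ g 0 p (t - p) b; rewrite addn0 subnK //; apply.
move=> m hm; rewrite /g -(osc_symmetry X_osc); last by lia.
by congr (D p _); lia.
Qed.

End Std.

End Oscillization.

Theorem theorem6p7 (r : nat) (r_ge1 : (1 <= r)%N) (c : seq int)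
    (T : seq 'rV[int]_r) (T_tab : fluctuating_tableau c T)
    (T_rect : rectangular T) :
  let t := (\sum_(x <- c) absz x)%N in
  let c1 := absz c`_0 in
  let sigma := long_cycle t in
  let w0 := longest t in
  exists p : nat -> {perm 'I_t},
    forall i : nat, (i <= r)%N ->
      [/\ prom i T =1 Some \o p i,
          p i = ((p (r - i)%N)^-1)%g,
          prom i (promotion T)
            =1 Some \o ((sigma ^- c1)%g \o p i \o (sigma ^+ c1)%g)
        & prom i (evacuation T) =1 Some \o (w0 \o p (r - i)%N \o w0)].
Proof.
rewrite /= -cum_size; set t := cum c (size c).
have [f [f_eq f_block f_part]] := oscillization (false, Ordinal r_ge1) T_tab.
have X_osc := osc_mkseq T_tab T_rect f_eq f_block f_part.
rewrite -/t in X_osc; set X := mkseq f t.+1 in X_osc.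
exists (osc_perm t X) => i le_i; rewrite /prom; split.
- rewrite (std_mkseq T_tab f_eq f_block) -/t -/X.
  by apply: prom_osc_relE => u v; apply: osc_permE.
- by rewrite (osc_perm_inv X_osc le_i) invgK.
- rewrite (std_promotion T_tab T_rect f_eq f_block f_part) -/t -/X.
  exact: osc_perm_promotion.
- rewrite (std_evacuation T_tab T_rect f_eq f_block f_part) -/t -/X.
  exact: osc_perm_evacuation.
Qed.
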